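(* Let $K$ be a Hilbertian field. If there exists a finite separable extension $L/K$ with $\mathrm{N}_{L/K}(L^\times)\subsetneq K^\times$, then $\mathrm{rk}^{\exists}_K(\mathrm{N}_{L/K}(L^\times))\geq 2$, and in particular $\mathrm{rk}^{\exists}(K)\geq2$.
   Context: $\mathrm{N}_{L/K}$ is the field norm. For a diophantine set $D\subseteq K^n$ (defined by an existential formula in the language of rings $\{+,-,\cdot,0,1\}$ with parameters from $K$), $\mathrm{rk}^{\exists}_K(D)$ is the least $m$ such that $D$ is defined in $K$ by a formula $\exists Y_1,\dots,Y_m\,\psi$ with $\psi$ quantifier-free with parameters from $K$; $\mathrm{rk}^{\exists}(K)=\sup_D\mathrm{rk}^{\exists}_K(D)$ over all diophantine $D\subseteq K^n$, all $n$. Hilbertian is meant in the standard sense (Fried–Jarden): for no $n$ is $K^n$ separably thin in $\mathbb{A}^n_K$. *)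

(* Defs.v *)
From HB Require Import structures.
From mathcomp Require Import all_boot all_order all_algebra all_field.
(* mpoly must be imported before the classical libraries: their notations clash
   in the other order. *)
From mathcomp Require Import mpoly.
From mathcomp Require Import boolp classical_sets constructive_ereal.

Set Implicit Arguments.
Unset Strict Implicit.
Unset Printing Implicit Defensive.

Import Order.TTheory GRing.Theory Num.Theory.
Local Open Scope classical_set_scope.
Local Open Scope ring_scope.

Section FieldNorm.
Variables (K : fieldType) (L : fieldExtType K).

(* Determinant of multiplication by x; the basis chosen is immaterial. *)
Definition field_norm (x : L) : K :=
  \det (passmx.mxof (vbasis {:L}) (vbasis {:L}) (amull x)).

Definition norm_group : set K := [set field_norm x | x in [set x : L | x != 0]].

End FieldNorm.

Section ExistentialRank.
Variable K : fieldType.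

(* psi ranges over quantifier-free formulas in the language of rings
   (rformula excludes inverses and the unit predicate) with constants from K.
   The variables 'X_0, ..., 'X_(n-1) are the coordinates of K^n and
   'X_n, ..., 'X_(n+m-1) are the quantified ones; any further variable of psi
   is evaluated to 0, i.e., is just another name for a constant. *)
Definition ex_definable (m n : nat) (D : set (n.-tuple K)) : Prop :=
  exists psi : GRing.formula K,
    [/\ GRing.qf_form psi, GRing.rformula psi &
        D = [set a : n.-tuple K |
               GRing.holds a (foldr GRing.Exists psi (iota n m))]].

Definition diophantine (n : nat) (D : set (n.-tuple K)) : Prop :=
  exists m, ex_definable m D.

(* The default value 0 is taken on non-diophantine sets, so a bound
   0 < ex_rank D entails that D is diophantine. *)
Definition ex_rank (n : nat) (D : set (n.-tuple K)) : nat :=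
  xget 0%N [set m | ex_definable m D /\
                    forall m', ex_definable m' D -> (m <= m')%N].

(* The supremum in the extended integers, hence +oo if ranks are unbounded. *)
Definition field_ex_rank : \bar int :=
  supremum 0%E [set r : \bar int |
    exists (n : nat) (D : set (n.-tuple K)),
      diophantine D /\ r = ((ex_rank D)%:Z)%:E].

(* Subsets of K viewed as subsets of K^1. *)
Definition in_K1 (A : set K) : set (1.-tuple K) := [set a | A (thead a)].

End ExistentialRank.

Section SeparablyThin.
Variables (K : fieldType) (n : nat).

Definition zero_locus (k : nat) (S : set {mpoly K[k]}) : set (k.-tuple K) :=
  [set a | forall q, S q -> q.@[tnth a] = 0].

(* K-points of a Zariski closed subset of affine n-space that is proper as a
   closed subscheme: the defining equations are not all the zero polynomial
   (they may still vanish on all of K^n when K is finite). *)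
Definition thin_type1 (A : set (n.-tuple K)) : Prop :=
  exists S : set {mpoly K[n]},
    (exists2 g, S g & g != 0) /\ A = zero_locus S.

Local Notation KT := {fraction {mpoly K[n]}}.

Section GenericPoint.
Variables (F : fieldExtType KT) (k : nat) (x : k.-tuple F).

Definition eval_ext (q : {mpoly K[k]}) : F :=
  mmap (fun c : K => (tofrac (c%:MP : {mpoly K[n]}))%:A) (tnth x) q.

(* The prime ideal of the K-variety in affine k-space with generic point x. *)
Definition generic_ideal : set {mpoly K[k]} := [set q | eval_ext q = 0].

End GenericPoint.

(* phi(W(K)) for an integral K-variety W and a dominant, generically finite,
   separable morphism phi : W -> A^n of degree at least 2.  An integral
   variety is covered by finitely many affine open subvarieties with the same
   function field, and thin_type2 is only used inside finite unions, so W may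
   be taken closed in some affine k-space and phi given by polynomials
   p_1, ..., p_n.  Then F is the function field of W, made an extension of the
   function field KT of A^n by the comorphism of phi (which maps the i-th
   coordinate of A^n to p_i(x)), and x is the generic point of W; the degree
   of phi is [F : KT], and W(K) is the set of common zeros of the ideal of W. *)
Definition thin_type2 (A : set (n.-tuple K)) : Prop :=
  exists (k : nat) (F : fieldExtType KT) (x : k.-tuple F)
         (p : n.-tuple {mpoly K[k]}),
    [/\ separable 1%AS {:F} /\ (1 < \dim {:F})%N,
        forall y : F, exists q r : {mpoly K[k]},
          eval_ext x r != 0 /\ y = eval_ext x q / eval_ext x r,
        forall i : 'I_n,
          eval_ext x (tnth p i) = (tofrac ('X_i : {mpoly K[n]}))%:A &
        A = [set [tuple (tnth p i).@[tnth a] | i < n]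
              | a in zero_locus (generic_ideal x)]].

Definition separably_thin (A : set (n.-tuple K)) : Prop :=
  exists (N : nat) (B : 'I_N -> set (n.-tuple K)),
    (forall j, thin_type1 (B j) \/ thin_type2 (B j)) /\
    A `<=` \bigcup_j B j.

End SeparablyThin.

Definition hilbertian (K : fieldType) : Prop :=
  forall n : nat, ~ separably_thin [set: n.-tuple K].

(* Main.v *)
(** Suppose that the norm group [D] is [{x | exists y, psi x y}] with [psi]
    quantifier-free, and let [F] in [K[X][Y]] be the product of the nonzero atoms
    of [psi].  If a point [x0] of [D] is such that every root of [F(x0, Y)] in [K]
    comes from a root of [F] over [K(X)] (or over its perfect closure, when [K] is
    perfect), then the truth of [psi] at [x0] depends only on which polynomials in
    [X] vanish identically, so [psi] holds generically and [D] contains all but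
    finitely many elements of [K], which a proper subgroup of [K^*] cannot do.

    Such an [x0] is found by Hilbertianity among the values of the norm form
    [N(T)].  Up to Frobenius twists, the remaining factors of [F] are separable
    without root in [K(X)], and they have no root in [K(T)] after [X := N(T)]: over
    [L] the algebra [L (x) L] has a rank one idempotent [e], and a root, being
    algebraic over the value of the norm, is constant along the curves
    [(w/s) (1 + (s^d - 1) e)] of constant norm [w^d].  Comparing [s = 1] with
    [s = w] brings the root down to [K(X)].  When [K] is imperfect, with [a] not a
    p-th power, [T] is replaced by [U^p + a V^p]: separable factors still acquire
    no root, since the derivatives of such a root vanish, and the condition that a
    non-p-th power of [K(X)] takes a p-th power value at [x0] becomes a proper
    Zariski closed condition on [(U, V)]. *)

Require Import Defs.
From HB Require Import structures.
From mathcomp Require Import all_boot all_order all_algebra all_field.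
From mathcomp Require Import mpoly.
From mathcomp Require Import boolp classical_sets constructive_ereal.
From mathcomp Require Import ring zify.

Set Implicit Arguments.
Unset Strict Implicit.
Unset Printing Implicit Defensive.

Import GRing.Theory.
Local Open Scope ring_scope.

Local Notation tofrac := (@FracField.tofrac _).

(** * Roots in a fraction field and separable factors *)

Lemma fracP (A : idomainType) (y : {fraction A}) :
  exists P Q : A, Q != 0 /\ y = tofrac P / tofrac Q.
Proof.
elim/quotW: y => r; exists \n_r, \d_r; split; first exact: denom_ratioP.
have d0 := denom_ratioP r.
apply: (mulIf (x := tofrac \d_r)); first by rewrite tofrac_eq0.
rewrite mulfVK ?tofrac_eq0 //; unlock FracField.tofrac; rewrite -[LHS]FracField.pi_mul.
apply/eqmodP; rewrite /= FracField.equivfE /FracField.mulf.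
by rewrite !numden_Ratio ?mulf_neq0 ?oner_neq0 // !mulr1 mulrC.
Qed.

Lemma common_denominator (A : idomainType) (G : {poly {fraction A}}) :
  exists (c : A) (G0 : {poly A}),
    c != 0 /\ map_poly tofrac G0 = tofrac c *: G.
Proof.
elim/poly_ind: G => [|G y [c [G0 [c0 hG]]]].
  by exists 1, 0; rewrite oner_neq0 map_poly0 scaler0.
have [P [Q [Q0 ->]]] := fracP y.
exists (c * Q), (Q *: G0 * 'X + (c * P)%:P); split; first by rewrite mulf_neq0.
rewrite rmorphD rmorphM /= map_polyZ map_polyX map_polyC /= hG.
rewrite !rmorphM /= scalerA scalerDr scalerAl [tofrac Q * _]mulrC; congr (_ + _).
rewrite -[RHS]mul_polyC -!polyCM; congr _%:P; rewrite -!mulrA; congr (_ * _).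
by rewrite mulrCA divff ?mulr1 ?tofrac_eq0.
Qed.

(** Denominators are collected in the single constant [c]. The sizes of the factors are kept, so
    inductions on the degree can use factorizations over the fraction field while staying over
    [A]. *)
Lemma factor_clear (A : idomainType) (G : {poly A}) (g1 g2 : {poly {fraction A}}) :
  map_poly tofrac G = g1 * g2 ->
  exists (c : A) (G1 G2 : {poly A}),
    [/\ c != 0, c *: G = G1 * G2, size G1 = size g1 & size G2 = size g2].
Proof.
move=> hG; have [c1 [G1 [c10 h1]]] := common_denominator g1.
have [c2 [G2 [c20 h2]]] := common_denominator g2.
have sz c (g : {poly {fraction A}}) H :
    c != 0 -> map_poly tofrac H = tofrac c *: g -> size H = size g.
  move=> c0 h; rewrite -(@size_map_inj_poly A _ tofrac) ?rmorph0 ?h //.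
    by rewrite size_scale ?tofrac_eq0.
  by move=> u v /eqP; rewrite tofrac_eq => /eqP.
exists (c1 * c2), G1, G2; split; rewrite ?mulf_neq0 //; last 2 first.
- exact: sz h1.
- exact: sz h2.
apply: (map_inj_poly (f := tofrac)); rewrite ?rmorph0 //.
  by move=> u v /eqP; rewrite tofrac_eq => /eqP.
rewrite map_polyZ hG /= [in RHS]rmorphM /= h1 h2 rmorphM.
by rewrite -scalerAl -scalerAr scalerA.
Qed.

(* [Q ^ m * S(P / Q)] for [S] of degree at most [m], without denominators. *)
Definition hmg (R : comNzRingType) m (S : {poly R}) (P Q : R) :=
  \sum_(i < m.+1) S`_i * P ^+ i * Q ^+ (m - i).

Lemma hmg_map (R R' : comNzRingType) (f : {rmorphism R -> R'}) m S P Q :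
  f (hmg m S P Q) = hmg m (map_poly f S) (f P) (f Q).
Proof.
rewrite rmorph_sum; apply: eq_bigr => i _.
by rewrite !rmorphM !rmorphXn coef_map.
Qed.

Lemma hmgM (R : comNzRingType) m (S : {poly R}) c P Q :
  hmg m S (c * P) (c * Q) = c ^+ m * hmg m S P Q.
Proof.
rewrite mulr_sumr; apply: eq_bigr => i _.
have -> : c ^+ m = c ^+ i * c ^+ (m - i) by rewrite -exprD subnKC // -ltnS.
by rewrite !exprMn; ring.
Qed.

Lemma hmg_div (F : fieldType) m (S : {poly F}) P Q :
  (size S <= m.+1)%N -> Q != 0 -> hmg m S P Q = Q ^+ m * S.[P / Q].
Proof.
move=> sS Q0; rewrite (horner_coef_wide _ sS) mulr_sumr; apply: eq_bigr => i _.
have -> : Q ^+ m = Q ^+ i * Q ^+ (m - i) by rewrite -exprD subnKC // -ltnS.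
by rewrite expr_div_n; field; exact: expf_neq0.
Qed.

(** Absence of roots in the fraction field, phrased without fractions so that it can be followed
    along ring morphisms. The exponent [size S] exceeds the degree by one, which only contributes a
    factor [Q]. *)
Definition rootless (A : idomainType) (S : {poly A}) :=
  forall P Q, Q != 0 -> hmg (size S) S P Q != 0.

Lemma tofrac_inj (A : idomainType) : injective (@FracField.tofrac A).
Proof. by move=> u v /eqP; rewrite tofrac_eq => /eqP. Qed.

Lemma size_map_tofrac (A : idomainType) (S : {poly A}) :
  size (map_poly tofrac S) = size S.
Proof. by rewrite size_map_inj_poly ?rmorph0 //; exact: tofrac_inj. Qed.

Lemma hmg_frac (A : idomainType) m (S : {poly A}) P Q :
  (size S <= m.+1)%N -> Q != 0 ->
  (hmg m S P Q == 0) = root (map_poly tofrac S) (tofrac P / tofrac Q).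
Proof.
move=> sS Q0; rewrite -tofrac_eq0 hmg_map /= hmg_div ?size_map_tofrac ?tofrac_eq0 //.
by rewrite mulf_eq0 expf_eq0 tofrac_eq0 (negPf Q0) andbF.
Qed.

Lemma rootlessP (A : idomainType) (S : {poly A}) :
  rootless S <-> forall y : {fraction A}, ~~ root (map_poly tofrac S) y.
Proof.
split=> [h y|h P Q Q0]; last by rewrite hmg_frac.
by have [P [Q [Q0 ->]]] := fracP y; rewrite -(@hmg_frac _ (size S)) //; apply: h.
Qed.

(* Separability over the fraction field, as a Bezout identity over [A] so that it is
   preserved by injective ring morphisms. *)
Definition sepB (A : idomainType) (S : {poly A}) :=
  exists (u v : {poly A}) (b : A), b != 0 /\ u * S + v * S^`() = b%:P.

Lemma sepB_map (A B : idomainType) (f : {rmorphism A -> B}) S :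
  injective f -> sepB S -> sepB (map_poly f S).
Proof.
move=> fI [u [v [b [b0 h]]]]; exists (map_poly f u), (map_poly f v), (f b); split.
  by rewrite -(rmorph0 f) (inj_eq fI).
by rewrite deriv_map -!rmorphM -rmorphD /= h map_polyC.
Qed.

Lemma sepB_factor (A : idomainType) (S G1 G2 : {poly A}) (c : A) :
  c != 0 -> c *: S = G1 * G2 -> sepB S -> sepB G1.
Proof.
move=> c0 hS [u [v [b [b0 h]]]].
exists (u * G2 + v * G2^`()), (v * G2), (c * b); split; first by rewrite mulf_neq0.
have -> : (c * b)%:P = u * (c *: S) + v * (c *: S)^`().
  by rewrite derivZ -!scalerAr -scalerDr h -mul_polyC polyCM.
by rewrite hS derivM; ring.
Qed.

Lemma sepB_coprime (A : idomainType) (S : {poly A}) :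
  coprimep (map_poly tofrac S) (map_poly tofrac S)^`() -> sepB S.
Proof.
move=> /Bezout_eq1_coprimepP [[u v] /= huv].
have [c1 [u0 [c10 h1]]] := common_denominator u.
have [c2 [v0 [c20 h2]]] := common_denominator v.
exists (c2 *: u0), (c1 *: v0), (c1 * c2); split; first by rewrite mulf_neq0.
apply: (map_inj_poly (f := tofrac)); rewrite ?rmorph0 //; first exact: tofrac_inj.
rewrite rmorphD /= ![map_poly _ (_ * _)]rmorphM /= !map_polyZ h1 h2 map_polyC.
rewrite -deriv_map /= rmorphM !scalerA [X in _ + X *: _ * _]mulrC -!scalerAl -scalerDr.
by rewrite mulrC huv alg_polyC.
Qed.

Lemma coprime_sepB (A : idomainType) (S : {poly A}) :
  sepB S -> coprimep (map_poly tofrac S) (map_poly tofrac S)^`().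
Proof.
move=> [u [v [b [b0 h]]]]; apply/Bezout_coprimepP.
exists (map_poly tofrac u, map_poly tofrac v) => /=.
rewrite deriv_map -!rmorphM -rmorphD h /= map_polyC /=.
by rewrite polyC_eqp1 tofrac_eq0.
Qed.

Lemma root_factor_clear (A : idomainType) (S : {poly A}) (a b : A) :
  b != 0 -> root (map_poly tofrac S) (tofrac a / tofrac b) ->
  exists (c : A) (S1 : {poly A}), c != 0 /\ c *: S = S1 * (b *: 'X - a%:P).
Proof.
move=> b0 /factor_theorem [g hg]; have [c [S1 [c0 h]]] := common_denominator g.
exists (c * b), S1; split; rewrite ?mulf_neq0 //.
apply: (map_inj_poly (f := tofrac)); rewrite ?rmorph0 //; first exact: tofrac_inj.
rewrite [map_poly _ (S1 * _)]rmorphM /= rmorphB /= !map_polyZ.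
rewrite map_polyX map_polyC /= hg h rmorphM -!mul_polyC polyCM.
have -> : (tofrac a)%:P = (tofrac b)%:P * (tofrac a / tofrac b)%:P.
by rewrite -polyCM mulrC divfK ?tofrac_eq0.
rewrite mulrBr -!mulrA; congr (_ * _).
by rewrite !mulrBr [in RHS]mulrCA ![(tofrac b)%:P * (g * _)]mulrCA.
Qed.

Lemma root_factor_size (A : idomainType) (S S1 : {poly A}) (a b c : A) :
  c != 0 -> b != 0 -> S != 0 -> c *: S = S1 * (b *: 'X - a%:P) ->
  S1 != 0 /\ (size S1 < size S)%N.
Proof.
move=> c0 b0 S0 h.
have s2 : size (b *: 'X - a%:P : {poly A}) = 2.
  rewrite size_polyDl ?size_scale ?size_polyX //.
  by rewrite size_polyN size_polyC; case: (a != 0).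
have S10 : S1 != 0.
  by apply: contraNneq S0 => S10; move/eqP: h; rewrite S10 mul0r scale_poly_eq0 (negPf c0).
split=> //; rewrite -(size_scale S c0) h size_mul //; last first.
  by rewrite -size_poly_eq0 s2.
by rewrite s2 addn2.
Qed.

(* A root [a / b] of [S] in the fraction field is split off as the factor
   [b Y - a]; this survives every specialization of the coefficients. *)
Lemma split_roots (A : idomainType) (K : fieldType) (S : {poly A}) :
  S != 0 -> sepB S ->
  exists (S1 : {poly A}) (rhos : seq (A * A)),
    [/\ rootless S1, sepB S1, (forall r, r \in rhos -> r.2 != 0) &
     forall (f : {rmorphism A -> K}) y, root (map_poly f S) y ->
       root (map_poly f S1) y \/ exists2 r, r \in rhos & f r.2 * y = f r.1].
Proof.
elim: {S}_.+1 {-2}S (ltnSn (size S)) => // k IH S; rewrite ltnS => sS S0 hS.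
have [hr|hr] := pselect (rootless S).
  by exists S, [::]; split => // f y ->; left.
have [y ry] : exists y, root (map_poly tofrac S) y.
  apply: contrapT => h; apply/hr/rootlessP => y; apply/negP => ry.
  by apply: h; exists y.
have [a [b [b0 hy]]] := fracP y; rewrite hy in ry.
have [c [S1 [c0 h]]] := root_factor_clear b0 ry.
have [S10 sS1] := root_factor_size c0 b0 S0 h.
have [S2 [rhos [r2 s2 hrhos h2]]] :=
  IH S1 (leq_trans sS1 sS) S10 (sepB_factor c0 h hS).
exists S2, ((a, b) :: rhos); split => // [r|f z rz].
  by rewrite inE => /orP[/eqP -> //|]; apply: hrhos.
have : root (map_poly f (c *: S)) z.
  by rewrite map_polyZ /root hornerZ (rootP rz) mulr0.
rewrite h rmorphM rmorphB /= map_polyZ map_polyX map_polyC rootM => /orP[/h2 [|]|].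
- by left.
- by move=> [r rin hr']; right; exists r; rewrite // inE rin orbT.
- rewrite /root !hornerE /= subr_eq0 => /eqP e; right.
  by exists (a, b); rewrite ?inE ?eqxx.
Qed.

(** The degree is positive and kills the leading coefficient, so the characteristic is a prime [p];
    every exponent that occurs is then a multiple of [p]. *)
Lemma deriv_eq0_compXn (A : idomainType) (F : {poly A}) :
  F^`() = 0 -> (1 < size F)%N ->
  exists (p : nat) (h : {poly A}),
    [/\ p \in [pchar A], F = h \Po 'X^p, h != 0 & (size h < size F)%N].
Proof.
move=> hF sF.
have hc i : F`_i.+1 *+ i.+1 = 0 by rewrite -coef_deriv hF coef0.
have [p hp] : exists p, p \in [pchar A].
  apply: (@natf0_pchar A (size F).-2.+1) => //.
  have : F`_(size F).-2.+1 * (size F).-2.+1%:R == 0 by rewrite mulr_natr hc.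
  rewrite mulf_eq0; case/orP => //.
  have -> : (size F).-2.+1 = (size F).-1 by lia.
  by rewrite -lead_coefE lead_coef_eq0 -size_poly_eq0; case: (size F) sF.
have pp := pcharf_prime hp; have p0 := prime_gt0 pp; have p1 := prime_gt1 pp.
pose h := \poly_(i < size F) F`_(i * p).
have hF' : F = h \Po 'X^p.
  apply/polyP => i; rewrite coef_comp_poly_Xn //; case: ifPn => pi; last first.
    apply/eqP; apply: contraNT pi => Fi; rewrite (dvdn_pcharf hp).
    case: i Fi => [|i Fi]; first by rewrite eqxx.
    have : F`_i.+1 * i.+1%:R == 0 by rewrite mulr_natr hc.
    by rewrite mulf_eq0; case/orP => // e; rewrite e in Fi.
  rewrite coef_poly divnK //; case: ltnP => // hi.
  by rewrite nth_default // (leq_trans hi) // leq_div.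
have F0 : F != 0 by rewrite -size_poly_gt0 ltnW.
have h0 : h != 0 by apply: contraNneq F0 => e; rewrite hF' e comp_poly0.
exists p, h; split=> //; have := congr1 (fun x : {poly A} => (size x).-1) hF'.
rewrite size_comp_poly size_polyXn /=; move: sF p1; clear.
by move: (size _) (size _) => b a; nia.
Qed.

(** Induction on the degree. If [F] is coprime to its derivative, its roots are split off; if the
    derivative vanishes, [F = h(Y^p)] and [y] is replaced by [y ^ p]; otherwise the gcd with the
    derivative is a proper factor. A triple [(A, B, q)] in [rhos] stands for the root [y] with
    [y ^ q = A / B]. The root [z] is a power of [y]; only its existence matters. *)
Lemma separable_decomposition (A : idomainType) (K : fieldType) (F : {poly A}) :
  F != 0 ->
  exists (Ss : seq {poly A}) (rhos : seq (A * A * nat)),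
    [/\ (forall S, S \in Ss -> rootless S /\ sepB S),
        (forall r, r \in rhos -> r.1.2 != 0 /\ [pchar A].-nat r.2) &
     forall (f : {rmorphism A -> K}) y, root (map_poly f F) y ->
       (exists S z, S \in Ss /\ root (map_poly f S) z) \/
       exists2 r, r \in rhos & f r.1.2 * y ^+ r.2 = f r.1.1].
Proof.
elim: {F}_.+1 {-2}F (ltnSn (size F)) => // k IH F; rewrite ltnS => sF F0.
have [cF|cF] := boolP (coprimep (map_poly tofrac F) (map_poly tofrac F)^`()).
  have [S1 [rhos [r1 s1 hrhos h1]]] := split_roots K F0 (sepB_coprime cF).
  exists [:: S1], [seq (r, 1%N) | r <- rhos]; split=> [S|r|f y ry].
  - by rewrite inE => /eqP ->.
  - by move=> /mapP[s /hrhos s0 ->].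
  - have [rz|[r rin hr]] := h1 f y ry.
      by left; exists S1, y; rewrite inE.
    by right; exists (r, 1%N); rewrite ?expr1 //; apply/mapP; exists r.
have [F'0|F'0] := eqVneq F^`() 0.
  have sF1 : (1 < size F)%N.
    rewrite ltnNge; apply: contra cF => sF1.
    rewrite deriv_map F'0 map_poly0 coprimep0 -size_poly_eq1 size_map_tofrac.
    by rewrite eqn_leq sF1 lt0n size_poly_eq0.
  have [p [h [hp hF h0 sh]]] := deriv_eq0_compXn F'0 sF1.
  have [Ss [rhos [hSs hrhos hh]]] := IH h (leq_trans sh sF) h0.
  exists Ss, [seq (r.1, (p * r.2)%N) | r <- rhos]; split => // [r|f y ry].
    move=> /mapP[s /hrhos [s0 sp] ->] /=; split => //.
    by rewrite pnatM sp andbT pnatE //; case/andP: hp.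
  have : root (map_poly f h) (y ^+ p).
    by move: ry; rewrite hF /root map_comp_poly map_polyXn horner_comp hornerXn.
  move=> /hh[|[r rin hr]]; first by left.
  by right; exists (r.1, (p * r.2)%N); rewrite ?exprM //; apply/mapP; exists r.
set g := gcdp (map_poly tofrac F) (map_poly tofrac F)^`() in cF.
have mF0 : map_poly tofrac F != 0 by rewrite -size_poly_eq0 size_map_tofrac size_poly_eq0.
have mF'0 : (map_poly tofrac F)^`() != 0.
  by rewrite deriv_map -size_poly_eq0 size_map_tofrac size_poly_eq0.
have sg1 : (1 < size g)%N.
  have : (size g != 0)%N by rewrite size_poly_eq0 gcdp_eq0 negb_and mF0.
  by move: cF; rewrite /coprimep -/g; case: (size g) => [|[]].
have sgF : (size g < size F)%N.
  rewrite -(size_map_tofrac F) (leq_ltn_trans _ (lt_size_deriv mF0)) //.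
  by apply: dvdp_leq => //; rewrite dvdp_gcdr.
have hg : map_poly tofrac F = (map_poly tofrac F %/ g) * g.
  by rewrite divpK // dvdp_gcdl.
have [c [G1 [G2 [c0 h s1 s2]]]] := factor_clear hg.
have [G10 G20] : G1 != 0 /\ G2 != 0.
  by apply/andP; rewrite -negb_or -mulf_eq0 -h scale_poly_eq0 negb_or c0.
have sG1 : (size G1 < size F)%N.
  have := congr1 (fun x : {poly A} => size x) h.
  rewrite size_scale // size_mul // s2 => ->.
  by case: (size g) sg1 => [|[|n]] // _; rewrite !addnS /= ltnS leq_addr.
have [Ss1 [rhos1 [hSs1 hrhos1 h1]]] := IH G1 (leq_trans sG1 sF) G10.
have sG2 : (size G2 < k)%N by rewrite s2 (leq_trans sgF sF).
have [Ss2 [rhos2 [hSs2 hrhos2 h2]]] := IH G2 sG2 G20.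
exists (Ss1 ++ Ss2), (rhos1 ++ rhos2); split=> [S|r|f y ry].
- by rewrite mem_cat => /orP[/hSs1|/hSs2].
- by rewrite mem_cat => /orP[/hrhos1|/hrhos2].
have : root (map_poly f (c *: F)) y.
  by rewrite map_polyZ /root hornerZ (rootP ry) mulr0.
rewrite h rmorphM rootM => /orP[/h1|/h2] [[S [z [Sin rz]]]|[r rin hr]].
- by left; exists S, z; rewrite mem_cat Sin.
- by right; exists r; rewrite // mem_cat rin.
- by left; exists S, z; rewrite mem_cat Sin orbT.
- by right; exists r; rewrite // mem_cat rin orbT.
Qed.

Local Open Scope classical_set_scope.

(** * Thin sets *)

Lemma rmorph_mpoly (R S : comNzRingType) k (f : {rmorphism {mpoly R[k]} -> S}) p :
  f p = mmap (fun c => f c%:MP) (fun i => f 'X_i) p.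
Proof.
rewrite {1}(mpolyE p) rmorph_sum; apply: eq_bigr => m _ /=.
rewrite -mul_mpolyC rmorphM mpolyXE_id rmorph_prod; congr (_ * _).
by apply: eq_bigr => i _; rewrite rmorphXn.
Qed.

Lemma mmap_ext (R S : nzRingType) k (f g : R -> S) (u v : 'I_k -> S) p :
  f =1 g -> u =1 v -> mmap f u p = mmap g v p.
Proof.
move=> fg uv; apply: eq_bigr => m _; rewrite fg; congr (_ * _).
by apply: eq_bigr => i _; rewrite uv.
Qed.

Section LastVariable.
Variables (R : comNzRingType) (n : nat).

Definition last_case (T : Type) (u : 'I_n -> T) (y : T) (i : 'I_n.+1) : T :=
  if unlift ord_max i is Some j then u j else y.

Lemma last_case_lift T (u : 'I_n -> T) y j : last_case u y (lift ord_max j) = u j.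
Proof. by rewrite /last_case liftK. Qed.

Lemma last_case_max T (u : 'I_n -> T) y : last_case u y ord_max = y.
Proof. by rewrite /last_case unlift_none. Qed.

Definition mpoly_last : {mpoly R[n.+1]} -> {poly {mpoly R[n]}} :=
  mmap (polyC \o @mpolyC n R) (last_case (fun j => ('X_j)%:P) 'X).

HB.instance Definition _ := GRing.RMorphism.copy mpoly_last mpoly_last.

Definition mpoly_lift : {mpoly R[n]} -> {mpoly R[n.+1]} :=
  mmap (@mpolyC n.+1 R) (fun j => 'X_(lift ord_max j)).

HB.instance Definition _ := GRing.RMorphism.copy mpoly_lift mpoly_lift.

Lemma mpoly_last_eval (S : comNzRingType) (f : {rmorphism {mpoly R[n]} -> S}) y q :
  (map_poly f (mpoly_last q)).[y] =
  mmap (fun c => f c%:MP) (last_case (fun j => f 'X_j) y) q.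
Proof.
pose F : {rmorphism _ -> S} := horner_eval y \o map_poly f \o mpoly_last.
rewrite -[LHS]/(F q) rmorph_mpoly; apply: mmap_ext => [c|i] /=.
  by rewrite /mpoly_last mmapC /= map_polyC /= /horner_eval hornerC.
rewrite /mpoly_last mmapX mmap1U /last_case.
by case: unliftP => [j _|_]; rewrite /horner_eval ?map_polyC ?map_polyX ?hornerC ?hornerX.
Qed.

Lemma mpoly_last_lift a : mpoly_last (mpoly_lift a) = a%:P.
Proof.
pose F : {rmorphism _ -> {poly {mpoly R[n]}}} := mpoly_last \o mpoly_lift.
rewrite -[LHS]/(F a) rmorph_mpoly [RHS]rmorph_mpoly; apply: mmap_ext => [c|i] /=.
  by rewrite /mpoly_lift mmapC /mpoly_last mmapC.
by rewrite /mpoly_lift mmapX mmap1U /mpoly_last mmapX mmap1U last_case_lift.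
Qed.

Lemma mpoly_last_surj h : exists q, mpoly_last q = h.
Proof.
exists (map_poly mpoly_lift h).['X_ord_max].
rewrite -horner_map /= -map_poly_comp /mpoly_last mmapX mmap1U last_case_max.
rewrite -[RHS]comp_polyXr; congr _.[_]; apply: eq_map_poly => a /=.
exact: mpoly_last_lift.
Qed.

End LastVariable.

Section Thin.
Variables (K : fieldType) (n : nat).
Local Notation A := {mpoly K[n]}.
Local Notation Q := {fraction A}.

(** The variety is the hypersurface [g(t, y) = 0] in affine space of dimension [n + 1], projected to
    its first [n] coordinates; its function field is [F]. *)
Lemma thin_type2_generator (F : fieldExtType Q) (y : F) (g : {poly A}) :
  separable 1%AS {:F} -> (1 < \dim {:F})%N -> g \is monic ->
  root (map_poly (in_alg F) (map_poly tofrac g)) y ->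
  (forall h : {poly Q}, root (map_poly (in_alg F) h) y ->
     (size h < size g)%N -> h = 0) ->
  (forall z : F, exists h : {poly Q}, z = (map_poly (in_alg F) h).[y]) ->
  exists2 B, thin_type2 B & forall (t : n.-tuple K) y0,
    root (map_poly (meval (tnth t)) g) y0 -> B t.
Proof.
move=> sepF dimF mg rg ming genF.
pose x := [tuple last_case (fun j => (tofrac ('X_j : A))%:A) y i | i < n.+1].
pose p := [tuple ('X_(lift ord_max i) : {mpoly K[n.+1]}) | i < n].
have ev q : eval_ext x q =
    (map_poly (in_alg F) (map_poly tofrac (mpoly_last q))).[y].
  rewrite -map_poly_comp /= mpoly_last_eval; apply: mmap_ext => // i.
  by rewrite tnth_mktuple.
exists [set [tuple (tnth p i).@[tnth a] | i < n]
         | a in zero_locus (generic_ideal x)]; last first.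
  move=> t y0 rt; exists [tuple last_case (tnth t) y0 i | i < n.+1]; last first.
    apply: eq_from_tnth => i; rewrite !tnth_mktuple mevalXU tnth_mktuple.
    by rewrite last_case_lift.
  move=> q; rewrite /generic_ideal /= ev => q0.
  have -> : q.@[tnth [tuple last_case (tnth t) y0 i | i < n.+1]] =
      (map_poly (meval (tnth t)) (mpoly_last q)).[y0].
    rewrite mpoly_last_eval; apply: mmap_ext => [c|i]; first by rewrite /= mevalC.
    rewrite tnth_mktuple /last_case; case: unliftP => // j _.
    by rewrite /= mevalXU.
  (* Since [g] is monic, division by it stays over [A]. The remainder vanishes at [y] and is shorter
     than [g], hence is zero: the ideal of the generic point consists of multiples of [g]. *)
  rewrite (Pdiv.RingMonic.rdivp_eq mg (mpoly_last q)).
  set r := Pdiv.Ring.rmodp _ _.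
  have r0 : r = 0.
    apply: (map_inj_poly (f := tofrac)); rewrite ?rmorph0 //; first exact: tofrac_inj.
    apply: ming; last by rewrite size_map_tofrac Pdiv.Ring.ltn_rmodp monic_neq0.
    move: q0; rewrite (Pdiv.RingMonic.rdivp_eq mg (mpoly_last q)) -/r.
    rewrite !rmorphD !rmorphM /= hornerD hornerM (rootP rg) mulr0 add0r => e.
    by rewrite /root e.
  by rewrite r0 addr0 rmorphM hornerM /= (rootP rt) mulr0.
exists n.+1, F, x, p; split => //.
- move=> z; have [h ->] := genF z; have [c [h0 [c0 hh]]] := common_denominator h.
  have [q hq] := mpoly_last_surj h0; have [r hr] := mpoly_last_surj (c%:P : {poly A}).
  have er : eval_ext x r = (tofrac c)%:A.
    by rewrite ev hr !map_polyC /= hornerC.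
  have c1 : (tofrac c)%:A != 0 :> F by rewrite -in_algE fmorph_eq0 tofrac_eq0.
  exists q, r; rewrite er; split => //.
  rewrite ev hq hh map_polyZ hornerZ /= mulrC -in_algE mulKf //.
- move=> i; rewrite ev tnth_mktuple /mpoly_last mmapX mmap1U last_case_lift.
  by rewrite !map_polyC hornerC.
Qed.

Lemma irreducible_min (E : fieldType) (F : fieldExtType E) (p h : {poly E}) (z : F) :
  irreducible_poly p -> root (map_poly (in_alg F) p) z ->
  root (map_poly (in_alg F) h) z -> (size h < size p)%N -> h = 0.
Proof.
move=> [sp irr] rp rh sh; apply/eqP; apply: contraTT sh => h0; rewrite -leqNgt.
have : gcdp p h %= p.
  apply: irr; last exact: dvdp_gcdl.
  apply/negP => /eqP s1.
  have /Bezout_eq1_coprimepP [[u v] /= huv] : coprimep p h by rewrite /coprimep s1.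
  have := congr1 (fun q => (map_poly (in_alg F) q).[z]) huv.
  rewrite rmorphD !rmorphM /= hornerD !hornerM (rootP rp) (rootP rh) !mulr0 addr0.
  by rewrite rmorph1 hornerC => /eqP; rewrite eq_sym oner_eq0.
move=> e; apply: dvdp_leq => //; rewrite -(eqp_dvdl _ e); exact: dvdp_gcdr.
Qed.

Lemma thin_irreducible (G : {poly A}) :
  irreducible_poly (map_poly tofrac G) -> sepB G -> (2 < size G)%N ->
  exists2 B, thin_type2 B & forall (t : n.-tuple K) y,
    root (map_poly (meval (tnth t)) G) y -> (lead_coef G).@[tnth t] != 0 -> B t.
Proof.
move=> irr sG s2; have [F dimF [z rz genz]] := irredp_FAdjoin irr.
rewrite size_map_tofrac in dimF.
set l := lead_coef G; set m := (size G).-1.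
have sm : size G = m.+1 by rewrite /m; case: (size G) s2.
have l0 : l != 0 by rewrite lead_coef_eq0 -size_poly_gt0 (leq_trans _ s2).
(* The monic polynomial with [g(l Y) = l ^ (m - 1) G(Y)]; its roots are [l] times those of [G]. *)
pose g : {poly A} := 'X^m + \poly_(i < m) (G`_i * l ^+ (m.-1 - i)).
have sg : size g = m.+1.
  by rewrite size_polyDl size_polyXn // ltnS size_poly.
have mg : g \is monic.
  rewrite monicE lead_coefDl ?lead_coefXn // size_polyXn ltnS; exact: size_poly.
have gl (R : comNzRingType) (f : {rmorphism A -> R}) y :
    (map_poly f g).[f l * y] = f l ^+ m.-1 * (map_poly f G).[y].
  rewrite rmorphD /= map_polyXn hornerD hornerXn (@horner_coef_wide _ m); last first.
    by rewrite (leq_trans (size_poly _ _)) // size_poly.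
  rewrite (@horner_coef_wide _ m.+1) ?(leq_trans (size_poly _ _)) ?sm //.
  rewrite big_ord_recr /= mulrDr addrC; congr (_ + _).
    rewrite mulr_sumr; apply: eq_bigr => i _; rewrite !coef_map coef_poly ltn_ord.
    rewrite /= rmorphM rmorphXn exprMn.
    have -> : f l ^+ m.-1 = f l ^+ (m.-1 - i) * f l ^+ i.
      rewrite -exprD subnK //; have := ltn_ord i; lia.
    ring.
  rewrite coef_map /= -lead_coefE -/l exprMn mulrA -exprSr.
  by congr (_ ^+ _ * _); rewrite /m; lia.
have l1 : (tofrac l)%:A != 0 :> F by rewrite -in_algE fmorph_eq0 tofrac_eq0.
have [B thB hB] : exists2 B, thin_type2 B & forall (t : n.-tuple K) y0,
    root (map_poly (meval (tnth t)) g) y0 -> B t.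
  apply: (@thin_type2_generator F ((tofrac l)%:A * z)).
  - rewrite -genz -adjoin_separable_eq; apply/separable_elementP.
    exists (map_poly (in_alg F) (map_poly tofrac G)); split => //.
      by apply/polyOver1P; exists (map_poly tofrac G).
    by rewrite separable_map unlock; exact: coprime_sepB.
  - by rewrite dimF; move: s2; case: (size G) => [|[]].
  - exact: mg.
  - have := gl _ (in_alg F \o tofrac : {rmorphism A -> F}) z.
    rewrite /= => e; rewrite -map_poly_comp /root e map_poly_comp /=.
    by rewrite (rootP rz) mulr0.
  - move=> h rh; rewrite sg -sm -(size_map_tofrac G) => sh.
    apply/eqP; rewrite -(comp_poly2_eq0 h (q := tofrac l *: 'X)); last first.
      by rewrite size_scale ?size_polyX ?tofrac_eq0.
    apply/eqP; apply: (irreducible_min irr rz).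
      rewrite /root map_comp_poly horner_comp map_polyZ map_polyX hornerZ hornerX.
      by rewrite (rootP rh).
    rewrite size_comp_poly2 ?size_scale ?size_polyX ?tofrac_eq0 //.
  - move=> w; have : w \in <<1; z>>%VS by rewrite genz memvf.
    move=> /Fadjoin_polyP[_ /polyOver1P[h ->] ->].
    exists (h \Po ((tofrac l)^-1 *: 'X)).
    rewrite map_comp_poly horner_comp map_polyZ map_polyX hornerZ hornerX /=.
    have -> : (tofrac l)^-1%:A = ((tofrac l)%:A)^-1 :> F by rewrite -[LHS]in_algE fmorphV.
    by rewrite mulKf.
exists B => // t y rt lt; apply: (hB t (l.@[tnth t] * y)).
by rewrite /root (gl _ (meval (tnth t))) (rootP rt) mulr0.
Qed.

Lemma separably_thinU (U V : set (n.-tuple K)) :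
  separably_thin U -> separably_thin V -> separably_thin (U `|` V).
Proof.
move=> [N [B [hB UB]]] [M [C [hC VC]]].
exists (N + M)%N, (fun j => match split j with inl i => B i | inr i => C i end).
split=> [j|t [/UB [i _ Bi]|/VC [i _ Ci]]]; first by case: (split j).
  by exists (unsplit (inl i)) => //; rewrite unsplitK.
by exists (unsplit (inr i)) => //; rewrite unsplitK.
Qed.

Lemma separably_thinS (U V : set (n.-tuple K)) :
  U `<=` V -> separably_thin V -> separably_thin U.
Proof.
by move=> UV [N [B [hB VB]]]; exists N, B; split=> //; apply: subset_trans VB.
Qed.

Lemma separably_thin1 (U : set (n.-tuple K)) :
  thin_type1 U \/ thin_type2 U -> separably_thin U.
Proof. by move=> hU; exists 1%N, (fun=> U); split=> // t Ut; exists ord0. Qed.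

Lemma thin_zeros (c : A) : c != 0 ->
  separably_thin [set t : n.-tuple K | c.@[tnth t] = 0].
Proof.
move=> c0; apply: separably_thin1; left; exists [set c]; split; first by exists c.
by apply/seteqP; split=> [t ct q ->|t]; [|apply].
Qed.

(** Induction on the degree. A constant acquires a root only on its zero set, and degree one is
    excluded by rootlessness. In higher degree an irreducible [G] gives a set of type 2 away from
    the zeros of its leading coefficient, and a reducible one is factored. *)
Lemma thin_roots (G : {poly A}) : rootless G -> sepB G ->
  separably_thin [set t : n.-tuple K | exists y, root (map_poly (meval (tnth t)) G) y].
Proof.
elim: {G}_.+1 {-2}G (ltnSn (size G)) => // k IH G; rewrite ltnS => sk rG sG.
have G0 : G != 0.
  apply/eqP => G0; have := rG 0 1 (oner_neq0 _).
  by rewrite G0 /hmg big1 ?eqxx // => i _; rewrite coef0 !mul0r.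
have [s1|s1] := leqP (size G) 1.
  have /size_poly1P [c c0 Gc] : size G == 1%N by rewrite eqn_leq s1 size_poly_gt0.
  apply: separably_thinS (thin_zeros c0) => t [y]; rewrite Gc map_polyC /root hornerC.
  by move=> /eqP.
have s2 : (2 < size G)%N.
  rewrite ltn_neqAle s1 andbT; apply/negP => /eqP e.
  move/rootlessP/(_ (- tofrac G`_0 / tofrac G`_1))/negP: rG; apply.
  have G1 : G`_1 != 0 by have := lead_coef_eq0 G; rewrite lead_coefE -e /= => ->.
  rewrite /root horner_coef size_map_tofrac -e !big_ord_recl big_ord0 /= !coef_map /=.
  by rewrite addr0 expr0 expr1 mulr1 mulrC divfK ?tofrac_eq0 // subrr.
have [irr|irr] := pselect (irreducible_poly (map_poly tofrac G)).
  have [B thB hB] := thin_irreducible irr sG s2.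
  have l0 : lead_coef G != 0 by rewrite lead_coef_eq0.
  apply: separably_thinS (separably_thinU (thin_zeros l0) (separably_thin1 (or_intror thB))) => t [y ry].
  by have [e|ne] := eqVneq (lead_coef G).@[tnth t] 0; [left|right; apply: hB ry ne].
have [q [sq1 qG sqG]] : exists q : {poly Q}, [/\ size q != 1%N, q %| map_poly tofrac G &
    (size q < size (map_poly tofrac G))%N].
  apply: contrapT => h; apply: irr; split; first by rewrite size_map_tofrac.
  move=> q sq qG; apply: contrapT => /negP nq; apply: h; exists q; split=> //.
  have mG0 : map_poly tofrac G != 0 by rewrite -size_poly_gt0 size_map_tofrac size_poly_gt0.
  by rewrite ltn_neqAle dvdp_leq // andbT dvdp_size_eqp.
have /factor_clear [c [G1 [G2 [c0 h e1 e2]]]] : map_poly tofrac G = (map_poly tofrac G %/ q) * q.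
  by rewrite divpK.
have [G10 G20] : G1 != 0 /\ G2 != 0.
  by apply/andP; rewrite -negb_or -mulf_eq0 -h scale_poly_eq0 negb_or c0.
have sz := congr1 (fun x : {poly A} => size x) h.
rewrite size_scale // size_mul // in sz.
have sG1 : (0 < size G1)%N by rewrite size_poly_gt0.
have sG2 : (0 < size G2)%N by rewrite size_poly_gt0.
rewrite size_map_tofrac -e2 in sqG; rewrite -e2 in sq1.
have r12 (H1 H2 : {poly A}) : c *: G = H1 * H2 -> rootless H1.
  move=> e; apply/rootlessP => y; apply/negP => ry; move/rootlessP/(_ y)/negP: rG; apply.
  have : root (map_poly tofrac (c *: G)) y by rewrite e rmorphM rootM ry.
  by rewrite map_polyZ rootZ // tofrac_eq0.
have h' : c *: G = G2 * G1 by rewrite mulrC.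
have lt1 : (size G1 < k)%N.
  rewrite (leq_trans _ sk) // sz.
  by case: (size G2) sq1 sG2 => [|[|m]] // _ _; rewrite !addnS /= ltnS leq_addr.
have lt2 : (size G2 < k)%N by rewrite (leq_trans sqG sk).
apply: separably_thinS (separably_thinU (IH G1 lt1 (r12 _ _ h) (sepB_factor c0 h sG))
   (IH G2 lt2 (r12 _ _ h') (sepB_factor c0 h' sG))) => t [y ry].
have : root (map_poly (meval (tnth t)) (c *: G)) y.
  by rewrite map_polyZ /root hornerZ (rootP ry) mulr0.
by rewrite h rmorphM rootM => /orP[]; [left|right]; exists y.
Qed.

End Thin.

(** The excluded points form a finite union of separably thin sets, which cannot be all of [K^n]. *)
Lemma hilbertian_avoid (K : fieldType) n (c : {mpoly K[n]})
    (Gs : seq {poly {mpoly K[n]}}) :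
  hilbertian K -> c != 0 -> (forall G, G \in Gs -> rootless G /\ sepB G) ->
  exists t : n.-tuple K, c.@[tnth t] != 0 /\
    forall G y, G \in Gs -> ~~ root (map_poly (meval (tnth t)) G) y.
Proof.
move=> hK c0 hGs; apply: contrapT => hN; apply: (hK n).
have : separably_thin ([set t : n.-tuple K | c.@[tnth t] = 0] `|`
    [set t | exists G y, G \in Gs /\ root (map_poly (meval (tnth t)) G) y]).
  apply: separably_thinU; first exact: thin_zeros.
  elim: Gs hGs {hN} => [_|G Gs IH hGs].
    by exists 0%N, (fun=> set0); split=> [[]|t [G [y []]]].
  have [rG sG] := hGs G (mem_head _ _).
  apply: separably_thinS (separably_thinU (thin_roots rG sG) (IH _)) => [t|H Hin]; last first.
    by apply: hGs; rewrite inE Hin orbT.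
  move=> [H [y [+ ry]]]; rewrite inE => /orP[/eqP e|Hin].
    by left; exists y; rewrite -e.
  by right; exists H, y.
apply: separably_thinS => t _.
have [e|ne] := eqVneq c.@[tnth t] 0; [by left|right].
apply: contrapT => h; apply: hN; exists t; split=> // G y Gin.
by apply/negP => ry; apply: h; exists G, y.
Qed.

(** * Substituting a norm-like form *)

Lemma rmorph_mmap (R S S' : comNzRingType) k (f : {rmorphism R -> S})
    (g : {rmorphism S -> S'}) (u : 'I_k -> S) p :
  g (mmap f u p) = mmap (g \o f) (g \o u) p.
Proof.
rewrite rmorph_sum; apply: eq_bigr => m _; rewrite rmorphM rmorph_prod /=.
by congr (_ * _); apply: eq_bigr => i _; rewrite rmorphXn.
Qed.

Lemma hilbertian_notin (K : fieldType) : hilbertian K ->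
  forall s : seq K, exists x, x \notin s.
Proof.
move=> hK s; pose c : {mpoly K[1]} := \prod_(a <- s) ('X_ord0 - a%:MP).
have c0 : c != 0.
  rewrite prodf_seq_neq0; apply/allP => a _ /=; apply/negP => /eqP e.
  have := congr1 (meval (fun=> a + 1)) e.
  rewrite mevalB mevalXU mevalC meval0 addrC addKr => /eqP.
  by rewrite oner_eq0.
have [t [ct _]] := hilbertian_avoid (Gs := [::]) hK c0 (fun G => ltac:(by [])).
exists (tnth t ord0); apply: contra ct => ts; rewrite /c rmorph_prod /=.
rewrite prodf_seq_eq0; apply/hasP; exists (tnth t ord0) => //=.
by rewrite mevalB mevalXU mevalC subrr.
Qed.

Lemma infinite_nonroot (K E : fieldType) (f : {rmorphism K -> E}) (h : {poly E}) :
  (forall s : seq K, exists x, x \notin s) -> h != 0 ->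
  exists x : K, h.[f x] != 0.
Proof.
move=> Kinf h0; apply: contrapT => hN.
have [s [us ss]] : exists s : seq K, uniq s /\ size s = size h.
  elim: (size h) => [|k [s [us <-]]]; first by exists [::].
  by have [x xs] := Kinf s; exists (x :: s); rewrite /= xs.
have := @max_poly_roots _ h (map f s) h0.
rewrite map_inj_uniq ?us; last exact: fmorph_inj.
rewrite size_map ss ltnn => /(_ _ isT)/negP; apply => //.
apply/allP => _ /mapP[x _ ->]; apply/eqP; apply: contrapT => e.
by apply: hN; exists x; apply/eqP.
Qed.

Lemma infinite_poly_eq0 (K E : fieldType) (f : {rmorphism K -> E}) (h : {poly E}) :
  (forall s : seq K, exists x, x \notin s) -> (forall x, h.[f x] = 0) -> h = 0.
Proof.
move=> Kinf hx; apply/eqP; apply/negPn/negP => /(infinite_nonroot f Kinf)[x].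
by rewrite hx eqxx.
Qed.

Lemma roots_seq (E : fieldType) (g : {poly E}) : g != 0 ->
  exists rs : seq E, forall x, root g x -> x \in rs.
Proof.
elim: {g}_.+1 {-2}g (ltnSn (size g)) => // k IH g; rewrite ltnS => sk g0.
have [[x rx]|h] := pselect (exists x, root g x); last first.
  by exists [::] => x rx; case: h; exists x.
have /factor_theorem [q gq] := rx.
have q0 : q != 0 by apply: contraNneq g0 => q0; rewrite gq q0 mul0r.
have [|rs hrs] := IH q _ q0.
  by rewrite (leq_trans _ sk) // gq size_mul ?polyXsubC_eq0 // size_XsubC addn2.
exists (x :: rs) => y; rewrite gq rootM root_XsubC inE => /orP[/hrs -> |->] //.
by rewrite orbT.
Qed.

Section Substitution.
Variables (K : fieldType) (n : nat).

Definition substX (Phi : {mpoly K[n]}) (g : {poly K}) : {mpoly K[n]} :=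
  (map_poly (@mpolyC n K) g).[Phi].

HB.instance Definition _ Phi := GRing.RMorphism.copy (substX Phi)
  (horner_eval Phi \o map_poly (@mpolyC n K)).

Lemma mmap_substX (S : comNzRingType) (f : {rmorphism K -> S}) v Phi g :
  mmap f v (substX Phi g) = (map_poly f g).[mmap f v Phi].
Proof.
rewrite /substX -horner_map /= -map_poly_comp; congr _.[_].
by apply: eq_map_poly => c /=; rewrite mmapC.
Qed.

End Substitution.

(** Restricts [p] to the rational curve [a(s) / s]. As [msize] exceeds the degree, [s ^ k] clears
    all denominators. *)
Lemma clear_curve (K E : fieldType) (f : {rmorphism K -> E}) n (a : 'I_n -> {poly E})
    (p : {mpoly K[n]}) k : (msize p <= k)%N ->
  exists P : {poly E}, forall s, s != 0 ->
    P.[s] = s ^+ k * mmap f (fun i => (a i).[s] / s) p.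
Proof.
move=> hk; exists (\sum_(m <- msupp p)
  (f p@_m)%:P * 'X^(k - mdeg m) * \prod_i (a i) ^+ m i) => s s0.
rewrite horner_sum mulr_sumr !big_seq; apply: eq_bigr => m hm.
rewrite !hornerM hornerC hornerXn horner_prod /mmap1.
have -> : \prod_(i < n) ((a i).[s] / s) ^+ m i =
    (\prod_(i < n) (a i ^+ m i).[s]) / s ^+ mdeg m.
  rewrite mdegE -prodrXr -prodf_div; apply: eq_bigr => i _.
  by rewrite expr_div_n hornerE.
have -> : s ^+ k = s ^+ (k - mdeg m) * s ^+ mdeg m.
  rewrite -exprD subnK // (leq_trans _ hk) // ltnW //; exact: msize_mdeg_lt.
by field; rewrite expf_neq0.
Qed.

Section PolySections.
Variables (R : comNzRingType) (d : nat) (d0 : (0 < d)%N).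

(** For [i < d], the component [p_i] in the decomposition [p = \sum_i X^i p_i(X^d)]. *)
Definition msection i (p : {poly R}) := \poly_(j < size p) p`_(j * d + i).

Lemma coef_msection i p j : (msection i p)`_j = p`_(j * d + i).
Proof.
rewrite coef_poly; case: ltnP => // hj; rewrite nth_default //.
by rewrite (leq_trans hj) // (leq_trans (leq_pmulr j d0)) // leq_addr.
Qed.

Lemma msection_neq0 (p : {poly R}) : p != 0 -> exists2 i, (i < d)%N & msection i p != 0.
Proof.
move=> p0; exists ((size p).-1 %% d)%N; first by rewrite ltn_mod.
apply/negP => /eqP/polyP/(_ ((size p).-1 %/ d)%N).
rewrite coef_msection coef0 -divn_eq => /eqP; rewrite -lead_coefE lead_coef_eq0.
exact/negP.
Qed.

(** Taking a component is linear over the polynomials in ['X^d]; this later turns an identity in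
    [w ^ d] into one in a free variable. *)
Lemma msectionM i (p q : {poly R}) : (i < d)%N ->
  msection i (p * (q \Po 'X^d)) = msection i p * q.
Proof.
move=> id; elim/poly_ind: q => [|q c IH].
  by rewrite comp_poly0 !mulr0; apply/polyP => j; rewrite coef_msection !coef0.
rewrite comp_polyD comp_polyM comp_polyX comp_polyC mulrDr mulrA.
rewrite [RHS]mulrDr [X in _ = X + _]mulrA -IH.
apply/polyP => j; rewrite coef_msection !coefD !coefMC coefMXn coefMX !coef_msection.
congr (_ + _); case: j => [|j]; first by rewrite mul0n add0n id.
by rewrite mulSn -addnA ltnNge leq_addr /= addKn.
Qed.

End PolySections.

(* For the norm form, [eps] is [tau] times a rank one idempotent. *)
Definition normlike (K E : fieldType) (f : {rmorphism K -> E}) (d n : nat)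
    (Phi : {mpoly K[n]}) :=
  forall tau : 'I_n -> K, Phi.@[tau] != 0 ->
  exists eps : 'I_n -> E, forall l m : E, l != 0 ->
    mmap f (fun i => l * f (tau i) + m * eps i) Phi =
    f Phi.@[tau] * l ^+ d.-1 * (l + m).

Section NoNewRoots.
Variables (K E : fieldType) (f : {rmorphism K -> E}) (d n : nat).
Hypotheses (hK : hilbertian K) (d0 : (0 < d)%N).
Variable Phi : {mpoly K[n]}.
Hypotheses (Phi0 : Phi != 0) (nPhi : normlike f d Phi).

Let Kinf := hilbertian_notin hK.

Lemma mpoly_nonroot (Q : {mpoly K[n]}) : Q != 0 -> exists t : 'I_n -> K, Q.@[t] != 0.
Proof.
move=> Q0; have [t [Qt _]] := hilbertian_avoid (Gs := [::]) hK Q0 (fun G => ltac:(by [])).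
by exists (tnth t).
Qed.

Lemma mmap_rmorph v (p : {mpoly K[n]}) : f p.@[v] = mmap f (fun i => f (v i)) p.
Proof. by rewrite /meval (rmorph_mmap idfun). Qed.

Lemma comp_scaleXn_neq0 (g : {poly K}) c : g != 0 -> c != 0 -> g \Po (c *: 'X^d) != 0.
Proof.
by move=> g0 c0; rewrite comp_poly_eq0 // size_scale // size_polyXn ltnS.
Qed.

(** By [normlike] with [m = 0], the form takes the value [c w ^ d] at [w t], where [c] is its value
    at [t]. Hence [g(Phi) = 0] makes [g(c X^d)] vanish at all nonzero elements of the infinite field
    [K]. *)
Lemma substX_inj : injective (substX Phi).
Proof.
apply: raddf_inj => g hg; apply/eqP; apply: contrapT => /negP g0.
have [t Pt] := mpoly_nonroot Phi0; have [eps he] := nPhi Pt.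
have := infinite_nonroot f Kinf (h := map_poly f ('X * (g \Po (Phi.@[t] *: 'X^d)))).
case=> [|w]; first by rewrite map_poly_eq0 mulf_neq0 ?polyX_eq0 ?comp_scaleXn_neq0.
rewrite horner_map fmorph_eq0 hornerM hornerX mulf_eq0 negb_or => /andP[w0].
rewrite horner_comp hornerZ hornerXn -(fmorph_eq0 f) -horner_map.
have fw0 : f w != 0 by rewrite fmorph_eq0.
have := he (f w) 0 fw0; rewrite addr0 -mulrA -exprSr prednK // => e.
by rewrite rmorphM rmorphXn -e -mmap_substX [substX _ _]hg rmorph0 eqxx.
Qed.

(** A root [P / Q] of [F(Phi)] is restricted to two lines: [w t], where [Phi = c w ^ d] and the root
    is [P1 / Q1] over [K], and [t + (x - 1) eps], where [Phi = c x] and the root is [P2 / Q2] over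
    [E]. Curves of constant [Phi] joining the two lines give [P1 / Q1 (w) = P2 / Q2 (w ^ d)].
    Comparing components modulo [d] makes [P2 / Q2] a quotient [A / B] over [K], which is a root of
    [F(c X, Y)]. *)
Theorem no_new_roots (F : {poly {poly K}}) :
  rootless F -> rootless (map_poly (substX Phi) F).
Proof.
move=> rF; apply: contrapT => rN.
have F0 : F != 0.
  apply/eqP => F0; have := rF 0 1 (oner_neq0 _).
  by rewrite F0 /hmg big1 ?eqxx // => i _; rewrite coef0 !mul0r.
set FP := map_poly (substX Phi) F in rN; pose m := size F.
have sFP : (size FP <= m.+1)%N by rewrite (leq_trans (size_poly _ _)).
have [P [Q [Q0 hPQ]]] : exists P Q, Q != 0 /\ hmg m FP P Q = 0.
  apply: contrapT => h; apply: rN; apply/rootlessP => y.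
  have [P [Q [Q0 ->]]] := fracP y; rewrite -(hmg_frac _ sFP) //.
  by apply/negP => /eqP e; apply: h; exists P, Q.
have [t] := mpoly_nonroot (mulf_neq0 Q0 Phi0).
rewrite mevalM mulf_eq0 negb_or => /andP[Qt Pt].
have [eps he] := nPhi Pt; set c := Phi.@[t] in Pt he.
have hv (S : comNzRingType) (g : {rmorphism K -> S}) v :
    hmg m (map_poly (fun h => (map_poly g h).[mmap g v Phi]) F) (mmap g v P) (mmap g v Q) = 0.
  have := congr1 (mmap g v) hPQ; rewrite [LHS]hmg_map [RHS]rmorph0 => <-.
  congr hmg; rewrite /FP -map_poly_comp; apply: eq_map_poly => h /=.
  by rewrite mmap_substX.
pose P1 := mmap (@polyC K) (fun i => (t i)%:P * 'X) P.
pose Q1 := mmap (@polyC K) (fun i => (t i)%:P * 'X) Q.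
pose u i : {poly E} := (f (t i))%:P + ('X - 1) * (eps i)%:P.
pose P2 := mmap (polyC \o f) u P.
pose Q2 := mmap (polyC \o f) u Q.
have ev1 (R : {mpoly K[n]}) w : (mmap (@polyC K) (fun i => (t i)%:P * 'X) R).[w] =
    R.@[fun i => w * t i].
  rewrite -[LHS]/(horner_eval w _) rmorph_mmap; apply: mmap_ext => [a|i] /=.
    by rewrite /horner_eval hornerC.
  by rewrite /horner_eval !hornerE mulrC.
have ev2 (R : {mpoly K[n]}) x : (mmap (polyC \o f) u R).[x] =
    mmap f (fun i => 1 * f (t i) + (x - 1) * eps i) R.
  rewrite -[LHS]/(horner_eval x _) rmorph_mmap; apply: mmap_ext => [a|i] /=.
    by rewrite /horner_eval hornerC.
  by rewrite /horner_eval /u !hornerE ?mul1r.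
have [j Fj] : exists j, F`_j != 0.
  by exists (size F).-1; rewrite -lead_coefE lead_coef_eq0.
(* Excludes [w = 0], the poles of [P1 / Q1], and the values [c w ^ d] at which [F] specializes to
   the zero polynomial; the coefficient [j] is a witness for the last. *)
pose bad := 'X * Q1 * (F`_j \Po (c *: 'X^d)).
have Q10 : Q1 != 0.
  apply: contraNneq Qt => e; have := ev1 Q 1; rewrite -/Q1 e horner0.
  by rewrite (meval_eq (v2 := t)) => [|i]; rewrite ?mul1r // => <-.
have Q20 : Q2 != 0.
  apply: contraNneq Qt => e; have := ev2 Q 1; rewrite -/Q2 e horner0 => /esym/eqP.
  rewrite (mmap_ext (g := f) (v := f \o t)) => [|//|i]; last by rewrite subrr mul0r addr0 mul1r.
  by rewrite -mmap_rmorph fmorph_eq0.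
have bad0 : bad != 0 by rewrite !mulf_neq0 ?polyX_eq0 ?comp_scaleXn_neq0.
have key w : bad.[w] != 0 -> f P1.[w] * Q2.[f w ^+ d] = f Q1.[w] * P2.[f w ^+ d].
  rewrite !hornerM hornerX !mulf_eq0 !negb_or => /andP[/andP[w0 Qw0]].
  rewrite horner_comp hornerZ hornerXn => Fw0.
  set W := f w; have W0 : W != 0 by rewrite fmorph_eq0.
  (* [a / s] is a curve on which [Phi] is constant, equal to [c w ^ d]; it passes through
     [w t] at [s = 1] and through [t + (w ^ d - 1) eps] at [s = w]. *)
  pose a i : {poly E} := (W * f (t i))%:P + W *: ('X^d - 1) * (eps i)%:P.
  pose k := maxn (msize P) (msize Q).
  have [Pw hPw] := @clear_curve _ _ f _ a P k (leq_maxl _ _).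
  have [Qw hQw] := @clear_curve _ _ f _ a Q k (leq_maxr _ _).
  have hPhi s : s != 0 -> mmap f (fun i => (a i).[s] / s) Phi = f c * W ^+ d.
    move=> s0; have Ws0 : W / s != 0 by rewrite mulf_neq0 ?invr_eq0.
    rewrite (mmap_ext (g := f)
      (v := fun i => (W / s) * f (t i) + (W * s ^+ d.-1 - W / s) * eps i)) //.
      rewrite he // -[X in W ^+ X](prednK d0) exprSr expr_div_n.
      by field; rewrite s0 expf_neq0.
    have sd : s ^+ d = s ^+ d.-1 * s by rewrite -exprSr prednK.
    by move=> i; rewrite /a !hornerE sd; field.
  pose ev := horner_eval (f c * W ^+ d) \o map_poly f.
  pose g := map_poly ev F.
  have g0 : g != 0.
    apply/negP => /eqP/polyP/(_ j); rewrite coef0 coef_map /= /horner_eval.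
    rewrite -rmorphXn -rmorphM horner_map => /eqP; rewrite fmorph_eq0.
    exact/negP.
  have [rs hrs] := roots_seq g0.
  have hs s : s != 0 -> hmg m g Pw.[s] Qw.[s] = 0.
    move=> s0; rewrite hPw // hQw // hmgM -[X in _ = X](mulr0 ((s ^+ k) ^+ m)).
    by congr (_ * _); rewrite -[RHS](hv _ f (fun i => (a i).[s] / s)) hPhi.
  (* On the curve the root satisfies the fixed nonzero polynomial [g], so it takes values in the
     finite list [rs]. Thus [h] vanishes on the infinite field [K], and one factor [Pw - z Qw] is
     zero: the root is the constant [z]. *)
  pose h := \prod_(z <- rs) (Pw - z *: Qw) * Qw * 'X.
  have h0 : h = 0.
    apply: (infinite_poly_eq0 Kinf (f := f)) => x; rewrite !hornerM hornerX.
    have [->|x0] := eqVneq (f x) 0; first by rewrite mulr0.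
    have [->|Qx0] := eqVneq Qw.[f x] 0; first by rewrite mulr0 mul0r.
    rewrite horner_prod; apply/eqP; rewrite !mulf_eq0 prodf_seq_eq0.
    rewrite (_ : has _ _) //; apply/hasP; exists (Pw.[f x] / Qw.[f x]); last first.
      by rewrite /= !hornerE divfK // subrr.
    apply: hrs; have := hs _ x0; rewrite hmg_div //; last first.
      by rewrite (leq_trans (size_poly _ _)).
    by move/eqP; rewrite mulf_eq0 expf_eq0 (negPf Qx0) andbF.
  have e1 R : mmap f (fun i => (a i).[1] / 1) R = f R.@[fun i => w * t i].
    rewrite mmap_rmorph; apply: mmap_ext => // i.
    by rewrite /a !hornerE expr1n subrr mulr0 mul0r addr0 divr1 rmorphM.
  have eW R : mmap f (fun i => (a i).[W] / W) R = (mmap (polyC \o f) u R).[W ^+ d].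
    rewrite ev2; apply: mmap_ext => // i; rewrite /a !hornerE.
    by field.
  have Qw1 : Qw.[1] = f Q1.[w] by rewrite hQw ?oner_neq0 // expr1n mul1r e1 ev1.
  have Pw1 : Pw.[1] = f P1.[w] by rewrite hPw ?oner_neq0 // expr1n mul1r e1 ev1.
  have Qwn0 : Qw != 0.
    by apply: contraNneq Qw0 => e; rewrite -(fmorph_eq0 f) -Qw1 e horner0.
  move/eqP: h0; rewrite !mulf_eq0 polyX_eq0 orbF (negPf Qwn0) orbF prodf_seq_eq0.
  move=> /hasP[z _] /=; rewrite subr_eq0 => /eqP Pz.
  have := hPw W W0; have := hQw W W0; rewrite !eW -/P2 -/Q2 => eQ eP.
  apply: (mulfI (expf_neq0 k W0)); rewrite mulrCA -eQ mulrCA -eP -Pw1 -Qw1 Pz !hornerZ.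
  by ring.
have keyp : map_poly f P1 * (Q2 \Po 'X^d) = map_poly f Q1 * (P2 \Po 'X^d).
  apply/eqP; rewrite -subr_eq0; apply/eqP.
  apply: (mulfI (x := map_poly f bad)); first by rewrite map_poly_eq0.
  rewrite mulr0; apply: (infinite_poly_eq0 Kinf (f := f)) => w.
  rewrite hornerM horner_map; have [->|bw] := eqVneq bad.[w] 0.
    by rewrite rmorph0 mul0r.
  by rewrite hornerD hornerN !hornerM !horner_map !horner_comp !hornerXn key // subrr mulr0.
(* In [keyp] the factors [P2] and [Q2] are evaluated at ['X^d]. Extracting a component [i] in which
   [Q1] is nonzero removes this power and leaves polynomials [A] and [B] over [K]. *)
have [i id Bi] := msection_neq0 d0 Q10.
set A := msection d i P1; set B := msection d i Q1 in Bi.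
have msmap (p : {poly K}) : msection d i (map_poly f p) = map_poly f (msection d i p).
  by apply/polyP => l; rewrite coef_msection // !coef_map /= coef_msection.
have AB : map_poly f A * Q2 = map_poly f B * P2.
  by have := congr1 (msection d i) keyp; rewrite !msectionM // !msmap.
have Phi2 : mmap (polyC \o f) u Phi = (f c)%:P * 'X.
  apply/eqP; rewrite -subr_eq0; apply/eqP.
  apply: (infinite_poly_eq0 Kinf (f := f)) => x.
  by rewrite hornerD hornerN ev2 he ?oner_neq0 // hornerM hornerC hornerX expr1n; ring.
pose F' := map_poly (comp_poly (c%:P * 'X)) F.
have hF' : hmg m F' A B = 0.
  apply: (map_inj_poly (f := f)); rewrite ?rmorph0 //; first exact: fmorph_inj.
  have := hv _ (polyC \o f) u; rewrite -/P2 -/Q2 Phi2 => h2.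
  rewrite hmg_map; apply: (mulfI (expf_neq0 m Q20)); rewrite mulr0 -hmgM.
  rewrite [Q2 * _]mulrC AB [Q2 * _]mulrC hmgM.
  rewrite -[RHS](mulr0 (map_poly f B ^+ m)) -h2; congr (_ * hmg _ _ _ _).
  rewrite /F' -map_poly_comp; apply: eq_map_poly => h /=.
  rewrite map_comp_poly rmorphM /= map_polyC map_polyX /comp_poly -map_poly_comp.
  by [].
(* The substitution [X := X / c] turns the root of [F(c X, Y)] into a root of [F] itself. *)
pose inv := comp_poly (c^-1%:P * 'X) : {poly K} -> {poly K}.
have cc (h : {poly K}) : inv (h \Po (c%:P * 'X)) = h.
  rewrite /inv -comp_polyA comp_polyM comp_polyC comp_polyX mulrA -polyCM divff //.
  by rewrite mul1r comp_polyXr.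
have sF : (size F <= m.+1)%N by [].
have B0 : inv B != 0.
  rewrite comp_poly_eq0 // mul_polyC size_scale ?size_polyX // invr_eq0 //.
have := congr1 inv hF'; rewrite [LHS]hmg_map /inv comp_poly0 => /eqP.
have -> : map_poly (comp_poly (c^-1%:P * 'X)) F' = F.
  by rewrite /F' -map_poly_comp; apply: map_poly_id => h _; exact: cc.
by rewrite (hmg_frac _ sF B0); move/rootlessP/(_ (tofrac (inv A) / tofrac (inv B)))/negP: rF.
Qed.
End NoNewRoots.

(** * The norm form *)

(** The block matrix [B] is factored into block triangular matrices in two ways, and the
    determinants are compared. *)
Lemma det_add1_rank1 (F : fieldType) n (c : 'cV[F]_n) (r : 'rV[F]_n) :
  \det (1%:M + c *m r) = 1 + (r *m c) 0 0.
Proof.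
pose B := block_mx (1%:M : 'M[F]_1) (- r) c 1%:M.
have e1 : B = block_mx 1%:M 0 c 1%:M *m block_mx 1%:M (- r) 0 (1%:M + c *m r).
  rewrite mulmx_block !(mul1mx, mul0mx, mulmx0, mulmx1, addr0) mulmxN.
  by rewrite [- _ + _]addrC addrK.
have e2 : B = block_mx 1%:M (- r) 0 1%:M *m block_mx (1%:M + r *m c) 0 c 1%:M.
  by rewrite mulmx_block !(mul1mx, mul0mx, mulmx0, mulmx1, add0r) mulNmx addrK.
have := congr1 determinant e1; rewrite {1}e2 !det_mulmx !det_ublock !det_lblock.
by rewrite !det1 !mul1r mulr1 det_mx11 !mxE => <-.
Qed.

Section NormForm.
Variables (K : fieldType) (L : fieldExtType K).
Local Notation d := (\dim {:L}).
Local Notation b := (vbasis {:L}).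

Definition mulmat (x : L) : 'M[K]_d := \matrix_(i, j) coord b j (x * b`_i).
Definition mulmatL (x : L) : 'M[L]_d := map_mx (in_alg L) (mulmat x).

Lemma mulmatE x i j : mulmat x i j = coord b j (x * b`_i).
Proof. by rewrite mxE. Qed.

Lemma field_normE x : field_norm x = \det (mulmat x).
Proof.
congr determinant; apply/matrixP => i j.
by rewrite mulmatE mxE /= /passmx.rVof mxE passmx.vecof_delta lfunE.
Qed.

Lemma vbasisE (x : L) : x = \sum_j coord b j x *: b`_j.
Proof. by rewrite {1}(coord_basis (vbasisP {:L}) (memvf x)). Qed.

Lemma mulmat_lin (I : finType) (c : I -> K) (u : I -> L) :
  mulmat (\sum_k c k *: u k) = \sum_k c k *: mulmat (u k).
Proof.
apply/matrixP => i j; rewrite mulmatE mulr_suml linear_sum summxE.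
by apply: eq_bigr => k _; rewrite -scalerAl linearZ /= mxE mulmatE.
Qed.

Lemma mulmatM x y : mulmat (x * y) = mulmat x *m mulmat y.
Proof.
apply/matrixP => i j; rewrite [RHS]mxE mulmatE.
rewrite [x * y]mulrC -mulrA {1}(vbasisE (x * b`_i)) mulr_sumr linear_sum.
apply: eq_bigr => k _; rewrite !mulmatE -scalerAr linearZ /=.
by [].
Qed.

Lemma mulmat1 : mulmat 1 = 1%:M.
Proof.
apply/matrixP => i j; rewrite mulmatE mul1r coord_free ?(basis_free (vbasisP _)) //.
by rewrite mxE eq_sym.
Qed.

Lemma field_norm_neq0 (x : L) : x != 0 -> field_norm x != 0.
Proof.
move=> x0; have := congr1 determinant (mulmatM x x^-1).
rewrite divff // mulmat1 det1 det_mulmx => /eqP; rewrite eq_sym.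
by apply: contraTneq => h; rewrite -field_normE h mul0r eq_sym oner_eq0.
Qed.

Lemma field_normM (x y : L) : field_norm (x * y) = field_norm x * field_norm y.
Proof. by rewrite !field_normE mulmatM det_mulmx. Qed.

Definition norm_form : {mpoly K[d]} :=
  \det (\matrix_(i, j) \sum_(k < d) (mulmat b`_k i j)%:MP * 'X_k).

Lemma mmap_norm_form (S : comNzRingType) (f : {rmorphism K -> S}) v :
  mmap f v norm_form = \det (\sum_(k < d) v k *: map_mx f (mulmat b`_k)).
Proof.
rewrite -[LHS](det_map_mx (mmap f v)); congr determinant; apply/matrixP => i j.
rewrite !mxE rmorph_sum summxE; apply: eq_bigr => k _.
by rewrite rmorphM /= mmapC mmapX mmap1U !mxE mulrC.
Qed.

Lemma norm_form_eval (t : 'I_d -> K) :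
  norm_form.@[t] = field_norm (\sum_k t k *: b`_k).
Proof.
rewrite /meval mmap_norm_form field_normE mulmat_lin; congr determinant.
by apply: eq_bigr => k _; congr (_ *: _); apply/matrixP => i j; rewrite mxE.
Qed.

Definition basis_col : 'cV[L]_d := \col_i b`_i.

(** The basis column is a common eigenvector of all multiplication matrices: row [i] is the
    expansion of [x * b_i] in the basis. *)
Lemma mulmatL_col x : mulmatL x *m basis_col = x *: basis_col.
Proof.
apply/colP => i; rewrite !mxE [RHS](vbasisE); apply: eq_bigr => j _.
by rewrite !mxE /= mulr_algl.
Qed.

Lemma mulmatL_lin (I : finType) (c : I -> K) (u : I -> L) :
  mulmatL (\sum_k c k *: u k) = \sum_k (c k)%:A *: mulmatL (u k).
Proof.
rewrite /mulmatL mulmat_lin rmorph_sum; apply: eq_bigr => k _.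
by rewrite /= map_mxZ.
Qed.

Lemma mulmatL_coord x : mulmatL x = \sum_k (coord b k x)%:A *: mulmatL b`_k.
Proof. by rewrite {1}(vbasisE x) mulmatL_lin. Qed.

Lemma mulmatLM x y : mulmatL (x * y) = mulmatL x *m mulmatL y.
Proof. by rewrite /mulmatL mulmatM map_mxM. Qed.

Lemma dim_gt0 : (0 < d)%N.
Proof. by rewrite adim_gt0. Qed.

Lemma vbasis_neq0 (i : 'I_d) : b`_i != 0.
Proof.
apply: (free_not0 (X := b)); first exact: basis_free (vbasisP _).
by rewrite mem_nth // size_tuple.
Qed.

(* If every [mulmatL x] acts on the columns of [A] as the scalar [x], commutativity
   of [L] forces each column to be proportional to the basis column. *)
Lemma eigen_rank1 (A : 'M[L]_d) :
  (forall x, mulmatL x *m A = x *: A) -> exists r : 'rV[L]_d, A = basis_col *m r.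
Proof.
move=> hA; pose i0 := Ordinal dim_gt0; exists (\row_l (A i0 l / b`_i0)).
have sym (i j k : 'I_d) : mulmat b`_i k j = mulmat b`_k i j by rewrite !mulmatE mulrC.
apply/matrixP => k l; rewrite mxE big_ord1 !mxE.
have : (mulmatL b`_i0 *m A) k l = (mulmatL b`_k *m A) i0 l.
  by rewrite !mxE; apply: eq_bigr => j _; rewrite [mulmatL _ _ _]mxE [mulmatL b`_k _ _]mxE sym.
rewrite !hA !mxE => e; rewrite mulrA -e mulrC mulKf //; exact: vbasis_neq0.
Qed.

(** The separability idempotent of [L (x) L], where [mulmatL x] represents [x (x) 1]. Write the
    minimal polynomial of a generator [th] as [chi = psi * ('X - th)] over [L]. Then
    [A = psi(mulmatL th)] satisfies [(mulmatL th - th) A = 0], so it has the form required by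
    [eigen_rank1], and dividing by [psi(th)] normalizes it. *)
Lemma norm_idempotent : separable 1%AS {:L} ->
  exists (eps : 'I_d -> L) (r : 'rV[L]_d),
    \sum_(k < d) eps k *: mulmatL b`_k = basis_col *m r /\ (r *m basis_col) 0 0 = 1.
Proof.
move=> sepL; pose th := separable_generator 1%AS {:L}.
have genL : {:L}%VS = <<1; th>>%VS.
  by apply: eq_adjoin_separable_generator => //; exact: sub1v.
have sth : separable_element 1%AS th := separable_generatorP _ _.
set chi := minPoly 1%AS th.
have [psi hpsi] : exists psi, chi = psi * ('X - th%:P).
  by apply/factor_theorem; exact: root_minPoly.
(* [psi(th)] is the derivative of [chi] at [th], nonzero by separability. *)
have psi0 : psi.[th] != 0.
  have := separable_root_der 1%AS th; rewrite sth /= => /negP h; apply/negP => /eqP e.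
  apply: h; rewrite /root -/chi hpsi derivM derivXsubC mulr1 hornerD hornerM.
  by rewrite hornerXsubC subrr mulr0 add0r e.
have [chi0 hchi] : exists chi0, chi = map_poly (in_alg L) chi0.
  by apply/polyOver1P; exact: minPolyOver.
(* The value at [mulmatL th] of the part of [p] of degree below [k]. *)
pose Lam (p : {poly L}) k := \sum_(j < k) p`_j *: mulmatL (th ^+ j).
pose k := size psi; pose A := Lam psi k.
have thA : mulmatL th *m A = th *: A.
  apply/eqP; rewrite -subr_eq0; apply/eqP.
  have <- : Lam chi k.+1 = 0.
    transitivity (mulmatL (\sum_(j < k.+1) chi0`_j *: th ^+ j)).
      by rewrite mulmatL_lin; apply: eq_bigr => j _; rewrite hchi coef_map.
    have -> : \sum_(j < k.+1) chi0`_j *: th ^+ j = chi.[th].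
      rewrite (@horner_coef_wide _ k.+1) ?hpsi ?(leq_trans (size_polyMleq _ _)) //.
        by rewrite -hpsi hchi; apply: eq_bigr => j _; rewrite coef_map /= mulr_algl.
      by rewrite size_XsubC addn2.
    have /rootP -> : root chi th by exact: root_minPoly.
    by apply/matrixP => i j; rewrite !mxE mul0r linear0 rmorph0.
  (* Here [chi = psi * 'X - psi * th]. The two boundary terms vanish: coefficient 0 of [psi * 'X],
     and coefficient [k = size psi] of [psi]. *)
  rewrite /Lam hpsi mulrBr; under [in RHS]eq_bigr do rewrite coefB coefMX coefMC scalerBl.
  rewrite sumrB; congr (_ - _).
    rewrite big_ord_recl /= scale0r add0r mulmx_sumr; apply: eq_bigr => j _.
    by rewrite -scalemxAr -mulmatLM -exprS.
  rewrite big_ord_recr /= nth_default // mul0r scale0r addr0 scaler_sumr.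
  by apply: eq_bigr => j _; rewrite scalerA mulrC.
have thA' j : mulmatL (th ^+ j) *m A = th ^+ j *: A.
  elim: j => [|j IH].
    by rewrite expr0 scale1r /mulmatL mulmat1 map_mx1 mul1mx.
  by rewrite exprSr mulmatLM -mulmxA thA -scalemxAr IH scalerA mulrC.
have xA x : mulmatL x *m A = x *: A.
  have : x \in <<1; th>>%VS by rewrite -genL memvf.
  move=> /Fadjoin_polyP[_ /polyOver1P[h ->] ->].
  have -> : (map_poly (in_alg L) h).[th] = \sum_(j < size h) h`_j *: th ^+ j.
    rewrite (@horner_coef_wide _ (size h)) ?size_map_poly //.
    by apply: eq_bigr => j _; rewrite coef_map /= mulr_algl.
  rewrite mulmatL_lin mulmx_suml scaler_suml; apply: eq_bigr => j _.
  by rewrite -scalemxAl thA' scalerA mulr_algl.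
have [r hr] := eigen_rank1 xA.
have Abeta : A *m basis_col = psi.[th] *: basis_col.
  rewrite horner_coef scaler_suml mulmx_suml; apply: eq_bigr => j _.
  by rewrite -scalemxAl mulmatL_col scalerA.
have rbeta : (r *m basis_col) 0 0 = psi.[th].
  pose i0 := Ordinal dim_gt0; apply: (mulfI (vbasis_neq0 i0)).
  have := congr1 (fun B : 'cV_d => B i0 0) Abeta.
  by rewrite hr -mulmxA mxE big_ord1 !mxE => ->; rewrite mulrC.
(* The coordinates of [A / psi(th)] with respect to the matrices [mulmatL b_i]. *)
exists (fun i => psi.[th]^-1 * \sum_(j < k) psi`_j * (coord b i (th ^+ j))%:A),
  (psi.[th]^-1 *: r).
split; last by rewrite -scalemxAl mxE rbeta mulVf.
rewrite -scalemxAr -hr /A /Lam; under eq_bigr do rewrite -scalerA scaler_suml.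
rewrite -scaler_sumr exchange_big /=; congr (_ *: _); apply: eq_bigr => j _.
rewrite [in RHS]mulmatL_coord scaler_sumr; apply: eq_bigr => i _.
by rewrite scalerA.
Qed.

Theorem norm_form_normlike : separable 1%AS {:L} -> normlike (in_alg L) d norm_form.
Proof.
move=> sepL t; rewrite norm_form_eval; set x0 := \sum_k _ => Nt.
have [eps [r [hr rb]]] := norm_idempotent sepL.
exists (fun k => x0 * eps k) => l m l0.
rewrite mmap_norm_form field_normE.
(* The eigenvector property gives [x0 e = mulmatL x0 *m e] for the idempotent [e = basis_col *m r].
   So [mulmatL x0] factors out, and the remaining determinant is [l ^ d (1 + m / l)]. *)
have -> : \sum_k (l * in_alg L (t k) + m * (x0 * eps k)) *: map_mx (in_alg L) (mulmat b`_k)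
    = mulmatL x0 *m (l *: (1%:M + (m / l) *: (basis_col *m r))).
  under eq_bigr do rewrite scalerDl -!scalerA.
  rewrite big_split /= -!scaler_sumr hr.
  rewrite -scalemxAr mulmxDr mulmx1 -scalemxAr mulmxA mulmatL_col -scalemxAl.
  rewrite [in RHS]scalerDr /x0 mulmatL_lin; congr (_ + _).
  by rewrite !scalerA; congr (_ *: _); field.
rewrite det_mulmx detZ scalemxAl det_add1_rank1 -scalemxAr mxE rb.
rewrite /mulmatL det_map_mx -!mulrA; congr (_ * _).
have -> : l ^+ d = l ^+ d.-1 * l by rewrite -exprSr prednK // dim_gt0.
by field.
Qed.

End NormForm.

(** * Imperfect fields *)

Lemma mpoly_alg_ind (R : comNzRingType) n (P : {mpoly R[n]} -> Prop) :
  (forall c, P c%:MP) -> (forall i, P 'X_i) ->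
  (forall p q, P p -> P q -> P (p + q)) ->
  (forall p q, P p -> P q -> P (p * q)) -> forall p, P p.
Proof.
move=> hC hX hD hM p; rewrite (mpolyE p); apply: big_ind => //; first by rewrite -mpolyC0.
move=> m _; rewrite -mul_mpolyC; apply: (hM) => //; rewrite mpolyXE_id.
apply: big_ind => // [|i _]; first by rewrite -mpolyC1.
elim: (m i) => [|k IH]; first by rewrite expr0 -mpolyC1.
by rewrite exprS; apply: hM.
Qed.

Lemma mderiv_exp (R : comNzRingType) n (i : 'I_n) (q : {mpoly R[n]}) k :
  (q ^+ k)^`M(i) = q ^+ k.-1 * q^`M(i) *+ k.
Proof.
elim: k => [|k IH]; first by rewrite expr0 -mpolyC1 mderivC mulr0n.
rewrite exprS mderivM IH; case: k {IH} => [|k].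
  by rewrite mulr0n mulr0 addr0 expr0 mulr1 mul1r.
by rewrite mulrnAr mulrA -exprS /= mulrC -mulrS.
Qed.

Section SubspaceHyperplane.
Variables (K : fieldType) (N : nat) (V : 'rV[K]_N -> Prop).
Hypotheses (V0 : V 0) (Vlin : forall c x y, V x -> V y -> V (c *: x + y)).

Lemma subspace_submx m (A : 'M[K]_(m, N)) x :
  (forall i, V (row i A)) -> (x <= A)%MS -> V x.
Proof.
move=> hA /submxP[u ->]; rewrite mulmx_sum_row.
apply: (big_ind V) => // [y z hy hz|i _]; first by rewrite -[y]scale1r; apply: Vlin.
by rewrite -[_ *: _]addr0; apply: Vlin.
Qed.

(** A matrix of maximal rank with rows in [V] spans [V], and a nonzero column of its cokernel is the
    required linear form. *)
Lemma subspace_hyperplane x0 : ~ V x0 ->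
  exists D : 'cV[K]_N, D != 0 /\ forall x, V x -> x *m D = 0.
Proof.
move=> Vx0.
pose P r := `[< exists A : 'M[K]_N, \rank A = r /\ forall i, V (row i A) >].
have exP : exists r, P r.
  by exists 0%N; apply/asboolP; exists 0; rewrite mxrank0; split => // i; rewrite row0.
have ubP r : P r -> (r <= N)%N by move=> /asboolP[A [<- _]]; exact: rank_leq_row.
case: (ex_maxnP exP ubP) => r /asboolP[A [rA hA]] maxr.
have subA x : V x -> (x <= A)%MS.
  move=> Vx; apply/negPn/negP => nx.
  have lt : (A < A + x)%MS.
    by rewrite ltmxE addsmxSl /= addsmx_sub submx_refl.
  have := rank_ltmx lt; rewrite ltnNge rA maxr //; apply/asboolP.
  exists (A + x)%MS; split => // i.
  apply: (@subspace_submx _ (col_mx A x)) => [j|].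
    rewrite -[j]splitK; case: (split j) => k /=; first by rewrite rowKu.
    by rewrite rowKd ord1 row_id.
  by rewrite (submx_trans (row_sub _ _)) // addsmxE.
have cA : cokermx A != 0.
  apply/eqP => cA; apply: Vx0; apply: (subspace_submx hA).
  by rewrite submxE cA mulmx0.
have [j hj] : exists j, col j (cokermx A) != 0.
  apply: contrapT => h; move/eqP: cA; apply; apply/matrixP => i j.
  have : col j (cokermx A) = 0 by apply/eqP/negPn/negP => hj; apply: h; exists j.
  by move/colP/(_ i); rewrite !mxE.
exists (col j (cokermx A)); split => // x /subA; rewrite submxE => /eqP e.
by rewrite colE mulmxA e mul0mx.
Qed.
End SubspaceHyperplane.

Section Frobenius.
Variables (K : fieldType) (p : nat) (hp : p \in [pchar K]).

Let p_prime := pcharf_prime hp.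
Let p0 : (0 < p)%N := prime_gt0 p_prime.

Section MpolyFrobenius.
Variable n : nat.
Local Notation A := {mpoly K[n]}.

Lemma mpoly_pchar : p \in [pchar A].
Proof. by apply: (rmorph_pchar (@mpolyC n K)). Qed.

(** Raises the variables to the power [p] but fixes the coefficients: the [K]-linear Frobenius, as
    opposed to the p-th power map. *)
Definition frob : A -> A := mmap (@mpolyC n K) (fun i => 'X_i ^+ p).
HB.instance Definition _ := GRing.RMorphism.copy frob frob.

Lemma frobE q : frob q = \sum_(m <- msupp q) q@_m *: 'X_[m] ^+ p.
Proof.
apply: eq_bigr => m _; rewrite mul_mpolyC; congr (_ *: _).
rewrite mpolyXE_id -prodrXl /mmap1; apply: eq_bigr => i _.
by rewrite -!exprM mulnC.
Qed.

Lemma frobC c : frob c%:MP = c%:MP. Proof. by rewrite /frob mmapC. Qed.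

Lemma frob_eval q w : (frob q).@[w] = q.@[fun i => w i ^+ p].
Proof.
rewrite -[LHS]/(meval w _) /frob rmorph_mmap; apply: mmap_ext => [c|i] /=.
  by rewrite mevalC.
by rewrite rmorphXn /= mevalXU.
Qed.

Lemma mulm_inj : injective (fun m : 'X_{1..n} => (m *+ p)%MM).
Proof.
move=> m m' /mnmP e; apply/mnmP => i; have := e i; rewrite !mulmnE => /eqP.
by rewrite eqn_pmul2r // => /eqP.
Qed.

Lemma mcoeff_frob q m : (frob q)@_(m *+ p) = q@_m.
Proof.
rewrite frobE [in RHS](mpolyE q) !raddf_sum; apply: eq_bigr => m' _ /=.
by rewrite !mcoeffZ mpolyXn !mcoeffX (inj_eq mulm_inj).
Qed.

Lemma frob_inj : injective frob.
Proof.
by move=> q q' e; apply/mpolyP => m; rewrite -mcoeff_frob e mcoeff_frob.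
Qed.

Lemma mderiv_pth i (q : A) : (q ^+ p)^`M(i) = 0.
Proof. by rewrite mderiv_exp (mulrn_pchar mpoly_pchar). Qed.

Lemma mderiv_frob i q : (frob q)^`M(i) = 0.
Proof.
rewrite frobE raddf_sum big1 // => m _ /=; by rewrite mderivZ mderiv_pth scaler0.
Qed.

Lemma mderiv0_frob (q : A) : (forall i, q^`M(i) = 0) -> exists q', q = frob q'.
Proof.
move=> hq.
have dvd m i : m \in msupp q -> (p %| m i)%N.
  rewrite mcoeff_msupp => qm; have [->|mi] := eqVneq (m i) 0%N; first exact: dvdn0.
  have hm : m = ((m - U_(i)) + U_(i))%MM.
    apply/mnmP => j; rewrite mnmDE mnmBE mnm1E; case: eqVneq => [<-|]; last first.
      by rewrite subn0 addn0.
    by rewrite subnK // lt0n.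
  have := congr1 (mcoeff (m - U_(i))%MM) (hq i); rewrite mcoeff_mderiv -hm mcoeff0.
  rewrite mnmBE mnm1E eqxx subn1 prednK ?lt0n // -mulr_natr => /eqP.
  by rewrite mulf_eq0 (negPf qm) /= -(dvdn_pcharf hp).
exists (\sum_(m <- msupp q) q@_m *: 'X_[[multinom (m i %/ p)%N | i < n]]).
rewrite rmorph_sum [LHS]mpolyE !big_seq; apply: eq_bigr => m hm.
rewrite /= -!mul_mpolyC rmorphM /= frobC; congr (_ * _).
rewrite /frob mmapX /mmap1 mpolyXE_id; apply: eq_bigr => i _.
by rewrite -exprM mnmE mulnC divnK // dvd.
Qed.

Lemma frob_pth (q : A) : (forall m, exists y, q@_m = y ^+ p) ->
  exists r, frob q = r ^+ p.
Proof.
move=> /choice[y hy]; exists (\sum_(m <- msupp q) y m *: 'X_[m]).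
rewrite -(pFrobenius_autE mpoly_pchar) rmorph_sum frobE; apply: eq_bigr => m _.
by rewrite /= pFrobenius_autE exprZn -hy.
Qed.

(** The coefficients of [frob T] have zero derivatives. Differentiating the equation of a root [y]
    gives [D y] times the value at [y] of the derivative polynomial, which is nonzero by
    separability. Hence all [D y] vanish, [y] comes through [frob], and [T] itself has a root. *)
Lemma frob_rootless (T : {poly A}) :
  sepB T -> rootless T -> rootless (map_poly frob T).
Proof.
move=> sT rT P Q Q0; apply/negP => /eqP; set T' := map_poly frob T.
have sT' : size T' = size T by rewrite size_map_inj_poly ?rmorph0 //; exact: frob_inj.
have T0 : (0 < size T)%N.
  rewrite size_poly_gt0; apply/eqP => T0; have := rT 0 1 (oner_neq0 _).
  by rewrite T0 /hmg big1 ?eqxx // => i _; rewrite coef0 !mul0r.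
rewrite sT'; move: T0; case hm: (size T) => [//|m] _ h.
(* Expanding the fraction makes its denominator [Q ^ p], whose derivatives vanish; only the
   numerator remains to be differentiated. *)
pose P1 := Q ^+ p.-1 * P; pose Q1 := Q ^+ p.-1 * Q.
have Q1E : Q1 = Q ^+ p by rewrite /Q1 -exprSr prednK.
have Q10 : Q1 != 0 by rewrite Q1E expf_neq0.
have h1 : hmg m.+1 T' P1 Q1 = 0 by rewrite hmgM h mulr0.
clearbody P1 Q1.
have rP : root (map_poly tofrac T') (tofrac P1 / tofrac Q1).
  by rewrite -(@hmg_frac _ m.+1) ?h1 // sT' hm.
have nP : hmg m T'^`() P1 Q1 != 0.
  rewrite hmg_frac //; last first.
    by rewrite (leq_trans (size_poly _ _)) // sT' hm.
  have cop := coprime_sepB (sepB_map frob_inj sT).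
  by rewrite -deriv_map /root; exact: coprimep_root cop rP.
have DP1 i : P1^`M(i) = 0.
  have : (hmg m.+1 T' P1 Q1)^`M(i) = P1^`M(i) * hmg m T'^`() P1 Q1.
    rewrite raddf_sum big_ord_recl /= expr0 mulr1.
    have DQ k : (Q1 ^+ k)^`M(i) = 0.
      by rewrite Q1E -exprM mulnC exprM mderiv_pth.
    rewrite mderivM DQ mulr0 addr0 coef_map /= mderiv_frob mul0r add0r mulr_sumr.
    apply: eq_bigr => j _; rewrite /bump /= add1n subSS !mderivM DQ mulr0 addr0 !coef_map /=.
    rewrite mderiv_frob mul0r add0r mderiv_exp /= coef_deriv coef_map /=.
    by rewrite !mulrnAr !mulrnAl mulrnAr; congr (_ *+ _); ring.
  rewrite h1 raddf0 => /esym/eqP; rewrite mulf_eq0 (negPf nP) orbF.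
  by move/eqP.
have [P2 eP2] := mderiv0_frob DP1.
have [Q2 eQ2] : exists Q2, Q1 = frob Q2.
  by apply: mderiv0_frob => i; rewrite Q1E mderiv_pth.
have Q20 : Q2 != 0 by apply: contraNneq Q10 => e; rewrite eQ2 e rmorph0.
have := rT P2 Q2 Q20; rewrite hm; apply/negP/negPn/eqP.
by apply: frob_inj; rewrite rmorph0 hmg_map /= -eP2 -eQ2.
Qed.

(* The vectors [(w^m)_m] with [frob q] a p-th power at [w] lie in a proper subspace. *)
Lemma pth_power_zeros (q : A) m0 : (forall y, q@_m0 != y ^+ p) ->
  exists h : A, h != 0 /\ forall w y, (frob q).@[w] = y ^+ p -> h.@[w] = 0.
Proof.
move=> hm0; pose ms := in_tuple (msupp q).
pose N := size (msupp q).
(* This is a linear subspace: the sum is additive in [x], scaling [x] by [c] multiplies it by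
   [c ^ p], and the p-th powers form a subfield. It is proper because the unit vector at [m0] yields
   the coefficient of [m0], which is not a p-th power. *)
pose V (x : 'rV[K]_N) := exists y, \sum_i q@_(tnth ms i) * x 0 i ^+ p = y ^+ p.
have pK := pFrobenius_autE hp.
have V0 : V 0.
  by exists 0; rewrite expr0n gtn_eqF // big1 // => i _; rewrite mxE expr0n gtn_eqF // mulr0.
have Vlin c x y : V x -> V y -> V (c *: x + y).
  move=> [u hu] [v hv]; exists (c * u + v).
  rewrite -(pK (c * u + v)) rmorphD rmorphM /= !pK -hu -hv mulr_sumr -big_split /=.
  apply: eq_bigr => i _; rewrite !mxE -(pK (_ + _)) rmorphD rmorphM /= !pK.
  by ring.
have qm0 : q@_m0 != 0 by apply: contraNneq (hm0 0) => ->; rewrite expr0n gtn_eqF.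
have m0q : m0 \in msupp q by rewrite mcoeff_msupp.
have im0 : (index m0 (msupp q) < N)%N by rewrite index_mem.
pose i0 := Ordinal im0.
have ti0 : tnth ms i0 = m0 by rewrite (tnth_nth m0) /= nth_index.
have [D [D0 hD]] : exists D : 'cV[K]_N, D != 0 /\ forall x, V x -> x *m D = 0.
  apply: (subspace_hyperplane V0 Vlin (x0 := delta_mx 0 i0)) => -[y].
  rewrite (bigD1 i0) //= mxE !eqxx expr1n mulr1 ti0 big1 ?addr0 => [e|i ne].
    by have := hm0 y; rewrite e eqxx.
  by rewrite mxE (negPf ne) andbF expr0n gtn_eqF // mulr0.
exists (\sum_i D i 0 *: 'X_[tnth ms i]); split.
  have [i Di] : exists i, D i 0 != 0.
    apply: contrapT => h; move/eqP: D0; apply; apply/colP => i; rewrite mxE.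
    by apply/eqP/negPn/negP => Di; apply: h; exists i.
  apply/eqP => /(congr1 (mcoeff (tnth ms i))); rewrite raddf_sum mcoeff0 /=.
  rewrite (bigD1 i) //= mcoeffZ mcoeffX eqxx mulr1 big1 ?addr0 => [|j ne].
    by move/eqP; rewrite (negPf Di).
  rewrite mcoeffZ mcoeffX; case: eqVneq => [e|]; last by rewrite mulr0.
  move/eqP: e; rewrite !(tnth_nth m0) /= nth_uniq ?msupp_uniq // => /eqP/val_inj e.
  by rewrite e eqxx in ne.
move=> w y hy; have : V (\row_i \prod_j w j ^+ (tnth ms i) j).
  exists y; rewrite -hy frobE raddf_sum /= [RHS]big_tnth; apply: eq_bigr => i _.
  by rewrite mevalZ rmorphXn /= mevalX mxE.
move/hD/matrixP/(_ 0 0); rewrite !mxE => e; rewrite raddf_sum /= -[RHS]e.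
by apply: eq_bigr => i _; rewrite mevalZ mevalX !mxE mulrC.
Qed.

End MpolyFrobenius.

Section Twisted.
Variables (a : K) (d : nat).
Hypothesis ha : forall y, a != y ^+ p.

Definition twist_var (S : comNzRingType) (f : K -> S) (v : 'I_(d + d) -> S) (i : 'I_d) : S :=
  v (lshift d i) + f a * v (rshift d i).

Definition twist : {mpoly K[d]} -> {mpoly K[d + d]} :=
  mmap (@mpolyC (d + d) K) (twist_var (@mpolyC (d + d) K) (fun k => 'X_k)).
HB.instance Definition _ := GRing.RMorphism.copy twist twist.

Lemma mmap_twist (S : comNzRingType) (f : {rmorphism K -> S}) v s :
  mmap f v (twist s) = mmap f (twist_var f v) s.
Proof.
rewrite /twist (rmorph_mmap _ (mmap f v)); apply: mmap_ext => [c|i] /=.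
  by rewrite mmapC.
by rewrite /twist_var rmorphD rmorphM /= mmapC !mmapX !mmap1U.
Qed.

Lemma twist_substX Phi g : substX (twist Phi) g = twist (substX Phi g).
Proof. by rewrite /twist mmap_substX. Qed.

(* [twist s] is a function of [U + a V]. *)
Lemma mderiv_twist s i : (twist s)^`M(rshift d i) = a *: (twist s)^`M(lshift d i).
Proof.
elim/mpoly_alg_ind: s => [c|j|s t hs ht|s t hs ht].
- by rewrite /twist mmapC !mderivC scaler0.
- rewrite /twist mmapX mmap1U /twist_var !mderivD !mderiv_mulC !mderivX !mnm1E.
  rewrite eq_lshift eq_rshift eq_lrshift eq_rlshift !mulr0n !scale0r mulr0 addr0 add0r.
  rewrite eq_sym; case: eqVneq => [->|_]; last by rewrite !mulr0n !scale0r mulr0 scaler0.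
  have mm (m : 'X_{1..d + d}) : (m - m)%MM = 0%MM.
    by apply/mnmP => k; rewrite mnmBE mnm0E subnn.
  by rewrite !scale1r !mm mul_mpolyC.
- by rewrite rmorphD !mderivD hs ht scalerDr.
- by rewrite rmorphM !mderivM hs ht -scalerAl -scalerAr scalerDr.
Qed.

(** The derivatives in [U_i] and [V_i] have p-th power coefficients and differ by the factor [a]. As
    [a] is not a p-th power, both vanish, so [twist s] is a polynomial in p-th powers of the
    variables with p-th power coefficients. *)
Lemma twist_pth s : (forall m, exists y, (twist s)@_m = y ^+ p) ->
  exists r, twist s = r ^+ p.
Proof.
move=> hs; set q := twist s in hs *.
have hD i m : exists y, (q^`M(i))@_m = y ^+ p.
  have [y hy] := hs (m + U_(i))%MM; exists (y *+ (m i).+1).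
  by rewrite mcoeff_mderiv hy -!(pFrobenius_autE hp) rmorphMn.
have Dl i : q^`M(lshift d i) = 0.
  apply/mpolyP => m; rewrite mcoeff0.
  have [y hy] := hD (rshift d i) m; have [z hz] := hD (lshift d i) m.
  move: hy; rewrite mderiv_twist mcoeffZ hz => e.
  apply/eqP; rewrite expf_eq0 p0 /=; apply/negPn/negP => z0.
  by have := ha (y / z); rewrite expr_div_n -e mulfK ?eqxx // expf_neq0.
have D0 i : q^`M(i) = 0.
  rewrite -[i]splitK; case: (split i) => j /=; first exact: Dl.
  by rewrite mderiv_twist Dl scaler0.
have [q' hq'] := mderiv0_frob D0; rewrite hq'.
by apply: frob_pth => m; have := hs (m *+ p)%MM; rewrite hq' mcoeff_frob.
Qed.

Lemma twist_normlike (E : fieldType) (f : {rmorphism K -> E}) k Phi :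
  normlike f k Phi -> normlike f k (twist Phi).
Proof.
move=> hPhi tau; rewrite /meval mmap_twist => ht.
have [eps he] := hPhi (twist_var idfun tau) ht.
(* The direction is lifted to the [U] coordinates alone, so that [U + a V] moves along [eps]. *)
exists (fun i => match split i with inl j => eps j | inr _ => 0 end) => l m l0.
rewrite mmap_twist -he //; apply: mmap_ext => // i.
have sl : split (lshift d i) = inl i by rewrite -[lshift d i]/(unsplit (inl i)) unsplitK.
have sr : split (rshift d i) = inr i by rewrite -[rshift d i]/(unsplit (inr i)) unsplitK.
by rewrite /twist_var sl sr /= rmorphD rmorphM; ring.
Qed.

End Twisted.
End Frobenius.

Lemma rootless_XnsubC (A : idomainType) p (g r : A) :
  (0 < p)%N -> rootless ('X^p - g%:P) -> r ^+ p != g.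
Proof.
move=> p0 /rootlessP/(_ (tofrac r)); apply: contraNneq => <-.
rewrite rmorphB /= map_polyXn map_polyC /root hornerD hornerN hornerXn hornerC /=.
by rewrite rmorphXn subrr.
Qed.

(** * Norms at which prescribed polynomials acquire no root *)

Section Avoid.
Variables (K : fieldType) (hK : hilbertian K).
Variables (L : fieldExtType K) (hsep : separable 1%AS {:L}).

Lemma norm_form_neq0 : norm_form L != 0.
Proof.
have : (norm_form L).@[fun k => coord (vbasis {:L}) k 1] != 0.
  by rewrite norm_form_eval -vbasisE field_norm_neq0 ?oner_neq0.
by apply: contraNneq => ->; rewrite meval0.
Qed.

Lemma norm_form_norm_group t : (norm_form L).@[t] != 0 -> norm_group L (norm_form L).@[t].
Proof.
rewrite norm_form_eval; set x := \sum_k _ => Nx; exists x => //=.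
apply: contraNneq Nx => ->; rewrite field_normE.
have -> : mulmat (0 : L) = 0 by apply/matrixP => i j; rewrite !mxE mul0r linear0.
by rewrite -(scale0r (0 : 'M[K]_(\dim {:L}))) detZ expr0n gtn_eqF ?dim_gt0 // mul0r.
Qed.

(** All conditions are pulled back to affine [n]-space by [X := Phi]; injectivity of this
    substitution keeps them nonzero and separable. *)
Lemma avoid_values n (Phi : {mpoly K[n]}) (c : {poly K}) (hs : seq {mpoly K[n]})
    (Ss : seq {poly {poly K}}) :
  injective (substX Phi) -> c != 0 -> (forall h, h \in hs -> h != 0) ->
  (forall S, S \in Ss -> rootless (map_poly (substX Phi) S) /\ sepB S) ->
  exists w : 'I_n -> K, [/\ c.[Phi.@[w]] != 0, (forall h, h \in hs -> h.@[w] != 0) &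
    forall S y, S \in Ss -> ~~ root (map_poly (horner_eval Phi.@[w]) S) y].
Proof.
move=> sI c0 hs0 hSs.
have cs0 : substX Phi c * \prod_(h <- hs) h != 0.
  rewrite mulf_neq0 ?prodf_seq_neq0 //; last by apply/allP => h /hs0.
  by rewrite -(rmorph0 (substX Phi)) (inj_eq sI).
have [|t [ct ht]] := hilbertian_avoid (Gs := map (map_poly (substX Phi)) Ss) hK cs0.
  by move=> _ /mapP[S /hSs [rS sS] ->]; split=> //; apply: sepB_map.
have ev g : (substX Phi g).@[tnth t] = g.[Phi.@[tnth t]].
  rewrite /meval mmap_substX; congr _.[_]; exact: map_poly_id.
exists (tnth t); move: ct; rewrite mevalM mulf_eq0 negb_or ev => /andP[ct pt]; split=> //.
  move: pt; rewrite rmorph_prod prodf_seq_neq0 => /allP pt h hh; exact: pt.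
move=> S y Sin; have := ht _ y (map_f _ Sin); rewrite -map_poly_comp.
by rewrite (eq_map_poly (g := horner_eval Phi.@[tnth t])) // => g /=; rewrite ev.
Qed.

Lemma norm_avoid (c : {poly K}) (Ss : seq {poly {poly K}}) :
  c != 0 -> (forall S, S \in Ss -> rootless S /\ sepB S) ->
  exists x, [/\ norm_group L x, c.[x] != 0 &
    forall S y, S \in Ss -> ~~ root (map_poly (horner_eval x) S) y].
Proof.
move=> c0 hSs; have nl := norm_form_normlike hsep.
have sI := substX_inj hK (dim_gt0 L) norm_form_neq0 nl.
(* The extra factor ['X] forces the value of the norm form to be nonzero, hence the norm of a
   nonzero element. *)
have [|//|S Sin|w [cw _ hw]] := @avoid_values _ (norm_form L) ('X * c) [::] Ss sI.
- by rewrite mulf_neq0 ?polyX_eq0.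
- have [rS sS] := hSs S Sin; split=> //.
  exact: (no_new_roots hK (dim_gt0 L) norm_form_neq0 nl).
move: cw; rewrite hornerM hornerX mulf_eq0 negb_or => /andP[N0 cN].
by exists (norm_form L).@[w]; split=> //; exact: norm_form_norm_group.
Qed.

(** The form used is the norm form at [U^p + a V^p], that is, [frob] applied to the twisted norm
    form [Phi1]. Rootlessness passes through the twist by [no_new_roots] and through [frob] by
    [frob_rootless]. *)
Lemma norm_avoid_imperfect p (a : K) (c : {poly K}) (Ss : seq {poly {poly K}})
    (gs : seq {poly K}) :
  p \in [pchar K] -> (forall y, a != y ^+ p) ->
  c != 0 -> (forall S, S \in Ss -> rootless S /\ sepB S) ->
  (forall g, g \in gs -> rootless ('X^p - g%:P)) ->
  exists x, [/\ norm_group L x, c.[x] != 0,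
    (forall S y, S \in Ss -> ~~ root (map_poly (horner_eval x) S) y) &
    forall g y, g \in gs -> y ^+ p != g.[x]].
Proof.
move=> hp ha c0 hSs hgs; have p0 := prime_gt0 (pcharf_prime hp).
have nl := twist_normlike (a := a) (norm_form_normlike hsep).
set Phi1 := twist a (norm_form L) in nl.
have ev1 w : Phi1.@[w] = (norm_form L).@[twist_var a idfun w].
  by rewrite /meval mmap_twist.
have Phi10 : Phi1 != 0.
  pose w (i : 'I_(\dim {:L} + \dim {:L})) := match split i with
    inl j => coord (vbasis {:L}) j 1 | inr _ => 0 end : K.
  have : Phi1.@[w] != 0.
    rewrite ev1 (meval_eq (v2 := fun k => coord (vbasis {:L}) k 1)) => [|i].
      by rewrite norm_form_eval -vbasisE field_norm_neq0 ?oner_neq0.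
    rewrite /twist_var /w -[lshift _ i]/(unsplit (inl i)) -[rshift _ i]/(unsplit (inr i)).
    by rewrite !unsplitK mulr0 addr0.
  by apply: contraNneq => ->; rewrite meval0.
have sI1 := substX_inj hK (dim_gt0 L) Phi10 nl.
have nnr := no_new_roots hK (dim_gt0 L) Phi10 nl.
pose Phi := frob p Phi1.
have sE g : substX Phi g = frob p (substX Phi1 g) by rewrite /Phi /frob mmap_substX.
have sI : injective (substX Phi).
  by move=> g h; rewrite !sE => /(frob_inj hp)/sI1.
have hg g : exists h : {mpoly K[\dim {:L} + \dim {:L}]}, g \in gs ->
    h != 0 /\ forall w y, (substX Phi g).@[w] = y ^+ p -> h.@[w] = 0.
  have [gin|] := boolP (g \in gs); last by exists 0.
  (* If some coefficient of [g(Phi1)] is not a p-th power, [pth_power_zeros] supplies a polynomial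
     condition. Otherwise [g(Phi1)] is a p-th power by [twist_pth], a new root of [Y^p - g],
     contradicting [no_new_roots]. *)
  have [[m0 hm0]|hN] := pselect (exists m0, forall y, (substX Phi1 g)@_m0 != y ^+ p).
    have [h [h0 hh]] := pth_power_zeros hp hm0; exists h => _; split=> // w y.
    by rewrite sE; apply: hh.
  have : exists r, substX Phi1 g = r ^+ p.
    rewrite twist_substX; apply: (twist_pth hp ha) => m; apply: contrapT => hm.
    apply: hN; exists m => y; apply/eqP => e; apply: hm; exists y.
    by rewrite -twist_substX.
  move=> [r hr]; have := nnr _ (hgs g gin).
  rewrite rmorphB /= map_polyXn map_polyC /= => /(rootless_XnsubC r p0).
  by rewrite hr eqxx.
have /choice [H hH] := hg.
have [|_ /mapP[g gin ->]|S Sin|w [cw hw Sw]] :=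
    @avoid_values _ Phi ('X * c) (map H gs) Ss sI.
- by rewrite mulf_neq0 ?polyX_eq0.
- by case: (hH g gin).
- have [rS sS] := hSs S Sin; split=> //.
  have -> : map_poly (substX Phi) S = map_poly (@frob K p _) (map_poly (substX Phi1) S).
    by rewrite -map_poly_comp; apply: eq_map_poly => g /=; rewrite sE.
  by apply: (frob_rootless hp); [exact: sepB_map|exact: nnr].
move: cw; rewrite hornerM hornerX mulf_eq0 negb_or => /andP[N0 cN].
exists Phi.@[w]; split=> //.
  rewrite /Phi frob_eval ev1 in N0 *; exact: norm_form_norm_group.
move=> g y gin; apply/eqP => e; have [_ hh] := hH g gin.
have := hw _ (map_f H gin); rewrite (hh w y) ?eqxx //.
by rewrite /meval mmap_substX (map_poly_id (fun _ _ => erefl)) e.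
Qed.

End Avoid.

(** * Formulas with one quantifier *)

Section Formulas.
Variable K : fieldType.

Definition ev2 (F : {poly {poly K}}) (x y : K) : K := (map_poly (horner_eval x) F).[y].

(* ['X_0] is the inner and ['X_1] the outer variable; the others evaluate to 0 in
   [[:: x; y]], and inverses do not occur in ring terms. *)
Fixpoint term_poly (t : GRing.term K) : {poly {poly K}} :=
  match t with
  | GRing.Var 0 => 'X%:P
  | GRing.Var 1 => 'X
  | GRing.Var _ => 0
  | GRing.Const c => c%:P%:P
  | GRing.NatConst n => n%:R
  | GRing.Add t1 t2 => term_poly t1 + term_poly t2
  | GRing.Opp t1 => - term_poly t1
  | GRing.NatMul t1 n => term_poly t1 *+ n
  | GRing.Mul t1 t2 => term_poly t1 * term_poly t2
  | GRing.Inv _ => 0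
  | GRing.Exp t1 n => term_poly t1 ^+ n
  end.

Lemma term_polyE x y t : GRing.rterm t ->
  GRing.eval [:: x; y] t = ev2 (term_poly t) x y.
Proof.
pose f : {rmorphism {poly {poly K}} -> K} := horner_eval y \o map_poly (horner_eval x).
rewrite /ev2 -[X in _ -> _ = X]/(f (term_poly t)).
elim: t => //= [[|[|k]]|c|n|t1 h1 t2 h2|t1 h1|t1 h1 n|t1 h1 t2 h2|t1 h1 n].
- by rewrite map_polyC /= /horner_eval hornerX hornerC.
- by rewrite map_polyX /horner_eval hornerX.
- by rewrite /= nth_nil -[RHS]/(f 0) rmorph0.
- by rewrite map_polyC /= /horner_eval !hornerC.
- by rewrite -[RHS]/(f n%:R) rmorph_nat.
- by move=> /andP[/h1 -> /h2 ->]; rewrite -[RHS]/(f (_ + _)) rmorphD.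
- by move=> /h1 ->; rewrite -[RHS]/(f (- _)) rmorphN.
- by move=> /h1 ->; rewrite -[RHS]/(f (_ *+ n)) rmorphMn.
- by move=> /andP[/h1 -> /h2 ->]; rewrite -[RHS]/(f (_ * _)) rmorphM.
- by move=> /h1 ->; rewrite -[RHS]/(f (_ ^+ n)) rmorphXn.
Qed.

Fixpoint atoms (f : GRing.formula K) : seq {poly {poly K}} :=
  match f with
  | GRing.Equal t1 t2 => [:: term_poly t1 - term_poly t2]
  | GRing.And f1 f2 | GRing.Or f1 f2 | GRing.Implies f1 f2 => atoms f1 ++ atoms f2
  | GRing.Not f1 => atoms f1
  | _ => [::]
  end.

Lemma qf_eval_atoms x y x' y' f : GRing.qf_form f -> GRing.rformula f ->
  (forall P, P \in atoms f -> (ev2 P x y == 0) = (ev2 P x' y' == 0)) ->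
  GRing.qf_eval [:: x; y] f = GRing.qf_eval [:: x'; y'] f.
Proof.
have split2 (s1 s2 : seq {poly {poly K}}) Q : (forall P, P \in s1 ++ s2 -> Q P) ->
    (forall P, P \in s1 -> Q P) /\ (forall P, P \in s2 -> Q P).
  by move=> h; split=> P hP; apply: h; rewrite mem_cat hP ?orbT.
elim: f => //= [t1 t2 _ /andP[r1 r2] h|f1 h1 f2 h2|f1 h1 f2 h2|f1 h1 f2 h2|f1 h1].
- have := h _ (mem_head _ _); rewrite !term_polyE // /ev2 !rmorphB /= !hornerD !hornerN.
  by rewrite !subr_eq0.
- by move=> /andP[q1 q2] /andP[r1 r2] /split2[a1 a2]; rewrite h1 // h2.
- by move=> /andP[q1 q2] /andP[r1 r2] /split2[a1 a2]; rewrite h1 // h2.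
- by move=> /andP[q1 q2] /andP[r1 r2] /split2[a1 a2]; rewrite h1 // h2.
- by move=> q1 r1 a1; rewrite h1.
Qed.

Lemma ex_definable_le1 m (D : set K) : (m <= 1)%N -> ex_definable m (in_K1 D) ->
  exists psi : GRing.formula K, [/\ GRing.qf_form psi, GRing.rformula psi &
    forall x, D x <-> exists y, GRing.qf_eval [:: x; y] psi].
Proof.
case: m => [|[|//]] _ [psi [qf rf hD]].
  (* Without quantifiers, ['X_1] is evaluated to 0 by default; the added conjunct fixes the new
     bound variable to that value. *)
  exists (GRing.And psi (GRing.Equal (GRing.Var K 1) (GRing.Const 0))).
  split=> [||x]; rewrite /= ?qf ?rf //.
  have -> : D x <-> in_K1 D [tuple x] by rewrite /in_K1 /= theadE.
  rewrite hD /=; split=> [h|[y /andP[h /eqP y0]]].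
    exists 0; rewrite eqxx andbT; apply/GRing.qf_evalP => //.
    by apply: GRing.eq_holds h => -[|[|i]] //=; rewrite nth_nil.
  move/(GRing.qf_evalP _ qf): h; rewrite y0.
  by apply: GRing.eq_holds => -[|[|i]] //=; rewrite nth_nil.
exists psi; split=> // x.
have -> : D x <-> in_K1 D [tuple x] by rewrite /in_K1 /= theadE.
rewrite hD /=; split=> [[y h]|[y h]]; exists y.
  exact/GRing.qf_evalP.
by move/(GRing.qf_evalP _ qf): h.
Qed.

End Formulas.

(** * Generic truth of formulas with one quantifier *)

Lemma pnat_gt0 (pi : nat_pred) n : pi.-nat n -> (0 < n)%N.
Proof. by case/andP. Qed.

Section GenericTruth.
Variables (K : fieldType).
Hypothesis Kinf : forall s : seq K, exists x, x \notin s.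

Lemma sum_expr_pchar (I : finType) (f : I -> K) q : [pchar K].-nat q ->
  (\sum_i f i) ^+ q = \sum_i f i ^+ q.
Proof.
move=> hq; apply: (big_morph (fun x => x ^+ q)) => [x y|].
  exact: exprDn_pchar.
by rewrite expr0n gtn_eqF // (pnat_gt0 hq).
Qed.

(* For [r = (A, B, q)], the polynomial [B ^ size P * P(X, y) ^ q] with [y ^ q = A / B]. *)
Definition rho_subst (P : {poly {poly K}}) (r : {poly K} * {poly K} * nat) : {poly K} :=
  \sum_(i < size P) P`_i ^+ r.2 * r.1.1 ^+ i * r.1.2 ^+ (size P - i).

(** The q-th power is additive, so [P(x, y) ^ q] depends on [y] only through [y ^ q = A / B], and it
    has the same zeros as [P(x, y)]. *)
Lemma rho_substE P r x y : [pchar K].-nat r.2 -> r.1.2.[x] != 0 ->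
  r.1.2.[x] * y ^+ r.2 = r.1.1.[x] -> ((rho_subst P r).[x] == 0) = (ev2 P x y == 0).
Proof.
case: r => [[A B] q] /= hq B0 hy; rewrite /rho_subst /ev2 /=.
have -> : (\sum_(i < size P) P`_i ^+ q * A ^+ i * B ^+ (size P - i)).[x] =
    B.[x] ^+ size P * (map_poly (horner_eval x) P).[y] ^+ q.
  rewrite [X in _ = _ * X ^+ _](@horner_coef_wide _ (size P)) ?size_poly //.
  rewrite sum_expr_pchar // mulr_sumr horner_sum.
  apply: eq_bigr => i _; rewrite !hornerM !horner_exp -hy coef_map /= /horner_eval.
  have -> : B.[x] ^+ size P = B.[x] ^+ i * B.[x] ^+ (size P - i).
    by rewrite -exprD subnKC // ltnW.
  by rewrite !exprMn exprAC; ring.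
by rewrite mulf_eq0 !expf_eq0 (negPf B0) andbF /= (pnat_gt0 hq).
Qed.

Variables (D : set K) (psi : GRing.formula K).
Hypotheses (qf : GRing.qf_form psi) (rf : GRing.rformula psi).
Hypothesis hD : forall x, D x <-> exists y, GRing.qf_eval [:: x; y] psi.

Definition atom_prod : {poly {poly K}} := \prod_(P <- atoms psi | P != 0) P.

Lemma atom_prod_neq0 : atom_prod != 0.
Proof. by rewrite prodf_seq_neq0; apply/allP => P _; apply/implyP. Qed.

Lemma atom_prod_ev2 x y P : ev2 atom_prod x y != 0 -> P \in atoms psi -> P != 0 ->
  ev2 P x y != 0.
Proof.
move=> + Pin P0; apply: contraNneq => e.
pose f : {rmorphism {poly {poly K}} -> K} := horner_eval y \o map_poly (horner_eval x).
rewrite -[ev2 _ _ _]/(f atom_prod) rmorph_prod prodf_seq_eq0.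
by apply/hasP; exists P; rewrite // P0; apply/eqP.
Qed.

(** Where this does not vanish, [atom_prod] stays nonzero as a polynomial in [Y], the denominators
    in [rhos] stay nonzero, and each atom vanishes on a branch of [rhos] only if it does so
    identically. *)
Definition generic_cond (rhos : seq ({poly K} * {poly K} * nat)) : {poly K} :=
  lead_coef atom_prod *
  \prod_(r <- rhos) (r.1.2 * \prod_(P <- atoms psi | rho_subst P r != 0) rho_subst P r).

Lemma generic_cond_neq0 rhos : (forall r, r \in rhos -> r.1.2 != 0) ->
  generic_cond rhos != 0.
Proof.
move=> hr; rewrite mulf_neq0 ?lead_coef_eq0 ?atom_prod_neq0 // prodf_seq_neq0.
apply/allP => r /hr r0; rewrite mulf_neq0 // prodf_seq_neq0.
by apply/allP => P _; apply/implyP.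
Qed.

Lemma generic_truth rhos x0 :
  (forall r, r \in rhos -> [pchar K].-nat r.2 /\
     forall x, r.1.2.[x] != 0 -> exists y, r.1.2.[x] * y ^+ r.2 = r.1.1.[x]) ->
  D x0 -> (generic_cond rhos).[x0] != 0 ->
  (forall y, ev2 atom_prod x0 y = 0 ->
     exists2 r, r \in rhos & r.1.2.[x0] * y ^+ r.2 = r.1.1.[x0]) ->
  forall x, (generic_cond rhos).[x] != 0 -> D x.
Proof.
move=> hr /hD[y0 hy0] gx0 hF x gx.
have gr z r : (generic_cond rhos).[z] != 0 -> r \in rhos -> r.1.2.[z] != 0 /\
    forall P, P \in atoms psi -> rho_subst P r != 0 -> (rho_subst P r).[z] != 0.
  rewrite hornerM mulf_eq0 negb_or horner_prod => /andP[_].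
  rewrite prodf_seq_neq0 => /allP h /h /=; rewrite hornerM mulf_eq0 negb_or => /andP[r0].
  rewrite horner_prod prodf_seq_neq0 => /allP hP; split=> // P Pin P0.
  by have := hP P Pin; rewrite P0.
(* If the witness [y0] is a zero of no nonzero atom, any [y] off the zeros of [atom_prod] at [x]
   gives all atoms the same truth values. *)
apply/hD; have [e|ne] := eqVneq (ev2 atom_prod x0 y0) 0; last first.
  have [y hy] : exists y, ev2 atom_prod x y != 0.
    apply: (infinite_nonroot idfun Kinf).
    apply: contraNneq gx => /polyP/(_ (size atom_prod).-1).
    rewrite coef0 coef_map /= -lead_coefE /horner_eval => e0.
    by rewrite hornerM e0 mul0r.
  exists y.
  rewrite (_ : GRing.qf_eval _ _ = GRing.qf_eval [:: x0; y0] psi) //.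
  apply: qf_eval_atoms => // P Pin.
  have [->|P0] := eqVneq P 0; first by rewrite /ev2 !rmorph0 !horner0.
  by rewrite !(negPf (atom_prod_ev2 _ Pin P0)).
(* Otherwise [y0] lies on a branch [r], and a point of the same branch above [x] serves as the
   witness. *)
have [r rin hry0] := hF y0 e; have [qr solr] := hr r rin.
have [r0 hP0] := gr x0 r gx0 rin; have [rx hPx] := gr x r gx rin.
have [y hy] := solr x rx; exists y.
rewrite (_ : GRing.qf_eval _ _ = GRing.qf_eval [:: x0; y0] psi) //.
apply: qf_eval_atoms => // P Pin.
rewrite -(rho_substE P qr rx hy) -(rho_substE P qr r0 hry0).
have [->|R0] := eqVneq (rho_subst P r) 0; first by rewrite !horner0.
by rewrite (negPf (hP0 P Pin R0)) (negPf (hPx P Pin R0)).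
Qed.

End GenericTruth.

(** For [z] nonzero, some [x] outside finitely many values has both [x] and [z x] generic, hence
    both norms; their quotient [z] is then a norm, so the norm group is everything. *)
Lemma norm_group_not_generic (K : fieldType) (L : fieldExtType K) (c : {poly K}) :
  (forall s : seq K, exists x, x \notin s) ->
  (norm_group L `<` [set x : K | x != 0])%classic -> c != 0 ->
  ~ forall x, c.[x] != 0 -> norm_group L x.
Proof.
move=> Kinf [_ hN] c0 h; apply: hN => z /= z0.
have cz : 'X * c * (c \Po (z *: 'X)) != 0.
  by rewrite !mulf_neq0 ?polyX_eq0 // comp_poly_eq0 // size_scale // size_polyX.
have [x /=] := infinite_nonroot idfun Kinf cz.
rewrite !hornerM hornerX horner_comp hornerZ hornerX !mulf_eq0 !negb_or.
move=> /andP[/andP[x0 /h [al al0 hal]] /h [be be0 hbe]].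
exists (be / al) => /=; first by rewrite mulf_neq0 // invr_eq0.
apply: (mulIf x0); rewrite -hbe -{1}hal -field_normM divfK //.
Qed.

(** * Excluding definitions with at most one quantifier *)

Section Rank1.
Variables (K : fieldType) (hK : hilbertian K).
Variables (L : fieldExtType K) (hsep : separable 1%AS {:L}).
Hypothesis hnorm : (norm_group L `<` [set x : K | x != 0])%classic.

Lemma pnat_root (q : nat) :
  (forall p, p \in [pchar K] -> forall x : K, exists y, y ^+ p = x) ->
  [pchar K].-nat q -> forall x : K, exists y, y ^+ q = x.
Proof.
move=> perf; elim/ltn_ind: q => q IH hq x.
have [q1|q1] := leqP q 1.
  have -> : q = 1%N by apply/eqP; rewrite eqn_leq q1 (pnat_gt0 hq).
  by exists x; rewrite expr1.
have pq := pdiv_dvd q; have pp := pdiv_prime q1.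
have pc : pdiv q \in [pchar K].
  by move/pnatP: hq => -> //; rewrite ltnW.
have hq' : [pchar K].-nat (q %/ pdiv q)%N.
  by move: hq; rewrite -{1}(divnK pq) pnatM => /andP[].
have [y hy] := IH _ (ltn_Pdiv (prime_gt1 pp) (ltnW q1)) hq' x.
have [z hz] := perf _ pc y; exists z.
by rewrite -(divnK pq) mulnC exprM hz.
Qed.

(** With [g = A B^(p-1)], the equation says that [B y ^ (p ^ (e - 1))] is a p-th root of [g(x)]. If
    [g] is not a p-th power in [K(X)], it joins [gs] and the branch has no point above an allowed
    [x]; if [g = (A' / B')^p], extracting the root lowers [e]. *)
Lemma reduce_rho p (A B : {poly K}) e : p \in [pchar K] -> B != 0 ->
  exists (rhos : seq ({poly K} * {poly K} * nat)) (gs : seq {poly K}),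
    [/\ (forall r, r \in rhos -> r.1.2 != 0 /\ r.2 = 1%N),
        (forall g, g \in gs -> rootless ('X^p - g%:P)) &
     forall x y, (forall g z, g \in gs -> z ^+ p != g.[x]) ->
       B.[x] * y ^+ (p ^ e)%N = A.[x] ->
       exists2 r, r \in rhos & r.1.2.[x] * y ^+ r.2 = r.1.1.[x]].
Proof.
move=> hp; have p0 := prime_gt0 (pcharf_prime hp).
elim: e A B => [|e IH] A B B0.
  exists [:: (A, B, 1%N)], [::]; split=> [r|//|x y _ h].
    by rewrite inE => /eqP ->.
  by exists (A, B, 1%N); rewrite ?inE.
pose g := A * B ^+ p.-1.
have Bp x : B.[x] ^+ p = B.[x] ^+ p.-1 * B.[x] by rewrite -exprSr prednK.
have hg x z : B.[x] * z ^+ p = A.[x] -> (B.[x] * z) ^+ p = g.[x].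
  by move=> h; rewrite /g hornerM horner_exp exprMn Bp -h; ring.
clearbody g.
have [rg|rg] := pselect (rootless ('X^p - g%:P)).
  exists [::], [:: g]; split=> [//|h|x y hx].
    by rewrite inE => /eqP ->.
  rewrite expnSr exprM => /hg e1.
  by have := hx g (B.[x] * y ^+ (p ^ e)%N) (mem_head _ _); rewrite e1 eqxx.
have [A' [B' [B'0 hAB]]] : exists A' B' : {poly K}, B' != 0 /\ A' ^+ p = g * B' ^+ p.
  apply: contrapT => hN; apply: rg; apply/rootlessP => z.
  have [A' [B' [B'0 ->]]] := fracP z; apply/negP => rz; apply: hN; exists A', B'; split=> //.
  apply: tofrac_inj; move: rz.
  rewrite rmorphB /= map_polyXn map_polyC /root hornerD hornerN hornerXn hornerC /= subr_eq0.
  rewrite expr_div_n => /eqP e1; rewrite rmorphM !rmorphXn /= -e1 divfK //.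
  by rewrite expf_neq0 // tofrac_eq0.
have [rhos [gs [h1 h2 h3]]] := IH A' (B * B') (mulf_neq0 B0 B'0).
exists rhos, gs; split=> // x y hx h; apply: h3 => //.
move: h; rewrite expnSr exprM => /hg e1.
apply: (fmorph_inj (pFrobenius_aut hp)); rewrite /= !pFrobenius_autE.
rewrite -horner_exp hAB !hornerM horner_exp mulrAC exprMn e1 //.
Qed.

Lemma reduce_rhos p (rhos0 : seq ({poly K} * {poly K} * nat)) : p \in [pchar K] ->
  (forall r, r \in rhos0 -> r.1.2 != 0 /\ [pchar K].-nat r.2) ->
  exists (rhos : seq ({poly K} * {poly K} * nat)) (gs : seq {poly K}),
    [/\ (forall r, r \in rhos -> r.1.2 != 0 /\ r.2 = 1%N),
        (forall g, g \in gs -> rootless ('X^p - g%:P)) &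
     forall x y, (forall g z, g \in gs -> z ^+ p != g.[x]) ->
       (exists2 r, r \in rhos0 & r.1.2.[x] * y ^+ r.2 = r.1.1.[x]) ->
       exists2 r, r \in rhos & r.1.2.[x] * y ^+ r.2 = r.1.1.[x]].
Proof.
move=> hp; elim: rhos0 => [_|[[A B] q] rhos0 IH h0].
  by exists [::], [::]; split=> // x y _ [].
have [|rhos [gs [h1 h2 h3]]] := IH.
  by move=> r rin; apply: h0; rewrite inE rin orbT.
have [/= B0 hq] := h0 _ (mem_head _ _).
have /p_natP [e he] : p.-nat q by rewrite -(eq_pnat _ (pcharf_eq hp)).
have [rhos' [gs' [h1' h2' h3']]] := reduce_rho A e hp B0.
exists (rhos' ++ rhos), (gs' ++ gs); split=> [r|g|x y hx [r]].
- by rewrite mem_cat => /orP[/h1'|/h1].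
- by rewrite mem_cat => /orP[/h2'|/h2].
rewrite inE => /orP[/eqP ->|rin] /= e1.
  rewrite he in e1; have [|r' rin' hr'] := h3' x y _ e1.
    by move=> g z gin; apply: hx; rewrite mem_cat gin.
  by exists r'; rewrite // mem_cat rin'.
have [|r' rin' hr'] := h3 x y _ (ex_intro2 _ _ r rin e1).
  by move=> g z gin; apply: hx; rewrite mem_cat gin orbT.
by exists r'; rewrite // mem_cat rin' orbT.
Qed.

Theorem norm_group_not_rank1 m : (m <= 1)%N -> ~ ex_definable m (in_K1 (norm_group L)).
Proof.
move=> m1 /(ex_definable_le1 m1) [psi [qf rf hD]].
have Kinf := hilbertian_notin hK.
have [Ss [rhos [hSs hrhos hF]]] := separable_decomposition K (atom_prod_neq0 psi).
have {}hrhos r : r \in rhos -> r.1.2 != 0 /\ [pchar K].-nat r.2.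
  by move=> /hrhos[r0 hr]; split=> //; rewrite -(eq_pnat _ (pchar_poly K)).
have hF' x y : (forall S y, S \in Ss -> ~~ root (map_poly (horner_eval x) S) y) ->
    ev2 (atom_prod psi) x y = 0 ->
    exists2 r, r \in rhos & r.1.2.[x] * y ^+ r.2 = r.1.1.[x].
  move=> hS /eqP e; have [[S [z [Sin rz]]]|//] := hF (horner_eval x) y e.
  by have := hS S z Sin; rewrite rz.
(* [generic_truth] needs every branch to have a point above each generic [x]. Over a perfect field
   p-power roots exist; otherwise [reduce_rhos] leaves only branches of exponent 1. *)
have [perf|nperf] := pselect (forall p, p \in [pchar K] ->
    forall x : K, exists y, y ^+ p = x).
  have c0 := generic_cond_neq0 psi (fun r rin => (hrhos r rin).1).
  have [x0 [Nx0 cx0 Sx0]] := norm_avoid hK hsep c0 hSs.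
  apply: (norm_group_not_generic Kinf hnorm c0).
  apply: (generic_truth Kinf qf rf hD _ Nx0 cx0) => [r rin|y]; last exact: hF'.
  have [r0 qr] := hrhos r rin; split=> // x rx.
  have [y hy] := pnat_root perf qr (r.1.1.[x] / r.1.2.[x]).
  by exists y; rewrite hy mulrC divfK.
have [p [a [hp ha]]] : exists (p : nat) (a : K),
    p \in [pchar K] /\ forall y, a != y ^+ p.
  apply: contrapT => h; apply: nperf => p hp x; apply: contrapT => hx; apply: h.
  by exists p, x; split=> // y; apply/eqP => e; apply: hx; exists y.
have [rhos' [gs [h1 h2 h3]]] := reduce_rhos hp hrhos.
have c0 := generic_cond_neq0 psi (fun r rin => (h1 r rin).1).
have [x0 [Nx0 cx0 Sx0 gx0]] := norm_avoid_imperfect hK hsep hp ha c0 hSs h2.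
apply: (norm_group_not_generic Kinf hnorm c0).
apply: (generic_truth Kinf qf rf hD _ Nx0 cx0) => [r rin|y /(hF' _ _ Sx0)].
  have [r0 ->] := h1 r rin; split=> // x rx.
  by exists (r.1.1.[x] / r.1.2.[x]); rewrite expr1 mulrC divfK.
exact: h3.
Qed.

End Rank1.

(** * Diophantine definition of the norm group and the supremum of ranks *)

Lemma mpoly_term (K : fieldType) k (p : {mpoly K[k]}) s :
  exists t : GRing.term K, GRing.rterm t /\
    forall e, GRing.eval e t = p.@[fun i => e`_(s + i)].
Proof.
elim/mpoly_alg_ind: p => [c|i|p q [t [rt ht]] [u [ru hu]]|p q [t [rt ht]] [u [ru hu]]].
- by exists (GRing.Const c); split=> // e; rewrite mevalC.
- by exists (GRing.Var K (s + i)); split=> // e; rewrite mevalXU.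
- by exists (GRing.Add t u); rewrite /= rt ru; split=> // e; rewrite mevalD ht hu.
- by exists (GRing.Mul t u); rewrite /= rt ru; split=> // e; rewrite mevalM ht hu.
Qed.

Lemma norm_group_definable (K : fieldType) (L : fieldExtType K) :
  ex_definable (\dim {:L}) (in_K1 (norm_group L)).
Proof.
set d := \dim {:L}.
(* The offset 1 leaves ['X_0] for the element of [K]; the coordinates of its preimage are
   quantified. Excluding 0 in the formula removes the norm of 0. *)
have [t [rt ht]] := mpoly_term (norm_form L) 1.
exists (GRing.And (GRing.Equal t (GRing.Var K 0))
   (GRing.Not (GRing.Equal (GRing.Var K 0) (GRing.Const 0)))).
split; rewrite /= ?rt //; apply/seteqP; split=> a; rewrite /in_K1 /=.
  move=> [x /= x0 hx]; apply/GRing.foldExistsP.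
  exists (thead a :: [seq coord (vbasis {:L}) i x | i : 'I_d]).
    move=> i; rewrite !inE mem_iota add1n ltnS => hi.
    case: i hi => [_|i]; first by case/tupleP: a hx => b a0; rewrite theadE.
    rewrite /= -leqNgt => di; rewrite !nth_default //.
      by rewrite size_map size_enum_ord.
    by rewrite size_tuple.
  split=> /=; last by rewrite -hx; apply/eqP; rewrite field_norm_neq0.
  rewrite ht -hx [in RHS](vbasisE x) -norm_form_eval; apply: meval_eq => i.
  by rewrite add1n /= (nth_map i) ?size_enum_ord // nth_ord_enum.
move=> /GRing.foldExistsP[e he [/=]]; rewrite ht.
have <- : thead a = e`_0.
  have := he 0%N; rewrite !inE mem_iota /= => /(_ isT) <-.
  by case/tupleP: a he => b a0 _; rewrite theadE.
move=> <- /eqP N0; exact: norm_form_norm_group.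
Qed.

Lemma ex_rankP (K : fieldType) n (D : set (n.-tuple K)) m :
  ex_definable m D -> ex_definable (ex_rank D) D.
Proof.
move=> hm; have exD : exists k, `[< ex_definable k D >] by exists m; apply/asboolP.
have : [set m | ex_definable m D /\
                    forall m', ex_definable m' D -> (m <= m')%N] (ex_rank D).
  apply: xgetPex; case: (ex_minnP exD) => k /asboolP hk mink.
  by exists k; split=> // k' hk'; apply: mink; apply/asboolP.
by case.
Qed.

(** [supremum] selects a least upper bound if there is one, so one is exhibited: the maximum of a
    bounded set, [+oo] for an unbounded one. *)
Lemma supremum_nat_ge (A : set (\bar int)) (k : nat) :
  (forall r, A r -> exists n : nat, r = n%:Z%:E) -> A k%:Z%:E ->
  (k%:Z%:E <= supremum 0 A)%E.
Proof.
move=> hA Ak; have : supremums A (supremum 0%E A).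
  rewrite /supremum; case: eqP => [e|_]; first by rewrite e in Ak.
  apply: xgetPex.
  have exA : exists n : nat, `[< A n%:Z%:E >] by exists k; apply/asboolP.
  have [[M hM]|hN] := pselect (exists M : nat, forall n : nat, A n%:Z%:E -> (n <= M)%N).
    have ubA n : `[< A n%:Z%:E >] -> (n <= M)%N by move=> /asboolP; apply: hM.
    case: (ex_maxnP exA ubA) => m /asboolP Am maxm; exists m%:Z%:E; split.
      by move=> r Ar; have [n e] := hA r Ar; rewrite e lee_fin lez_nat maxm // -e; apply/asboolP.
    by move=> u; apply.
  exists +oo%E; split=> [r _|u hu]; first exact: leey.
  case: u hu => [z||] hu //; last by have := hu _ Ak; rewrite leeNy_eq.
  case: hN; exists `|z|%N => n An; have := hu _ An; rewrite lee_fin => h.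
  by rewrite -lez_nat (Order.POrderTheory.le_trans h) // abszE Num.Theory.ler_norm.
by move=> [ub _]; exact: ub.
Qed.

Theorem theorem8p9 (K : fieldType) (hK : hilbertian K)
    (L : fieldExtType K) (hsep : separable 1%AS {:L})
    (hnorm : norm_group L `<` [set c : K | c != 0]) :
  (2 <= ex_rank (in_K1 (norm_group L)))%N /\
  (2%:Z%:E <= field_ex_rank K)%E.
Proof.
have dD := norm_group_definable L; have rD := ex_rankP dD.
have r2 : (2 <= ex_rank (in_K1 (norm_group L)))%N.
  by rewrite ltnNge; apply/negP => /(norm_group_not_rank1 hK hsep hnorm).
split=> //; apply: (@Order.POrderTheory.le_trans _ _ (ex_rank (in_K1 (norm_group L)))%:Z%:E).
  by rewrite lee_fin lez_nat.
apply: supremum_nat_ge => [r [n [D [_ ->]]]|]; first by exists (ex_rank D).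
by exists 1%N, (in_K1 (norm_group L)); split=> //; exists (\dim {:L}).
Qed.
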